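(* Let $(r_n)_{n\ge1}$ be a sequence satisfying at least one of the following: (a) $(r_n)$ is a decreasing sequence of positive numbers with $r_n\to0$, $r_n<\frac1n$ for all $n$, and $|\log r_n|=o(n)$ as $n\to\infty$; (b) $r_n=e^{-n^\alpha}$ for all $n$, for some $0<\alpha<2$. Let $S=\bigcap_{m=1}^\infty\bigcup_{n=m}^\infty V_n$ be the corresponding uniform $G_\delta$-set. Then for every interval $J\subset[0,1]$, $$\mathrm{Cap}(J\cap S)=\mathrm{Cap}(J).$$
   Context: For a compactly supported Borel measure $\mu$ on $\mathbb{C}$, its energy is $I(\mu):=\iint -\log|z-w|\,d\mu(z)\,d\mu(w)$ (possibly $+\infty$). For a bounded Borel set $X\subset\mathbb{C}$, let $\mathcal{P}(X)$ be the set of Borel probability measures supported on $X$ (i.e. $\mu(\mathbb{C}\setminus X)=0$); the logarithmic capacity of $X$ is $\mathrm{Cap}(X):=\exp(-\inf\{I(\mu)\mid \mu\in\mathcal{P}(X)\})$, with $\exp(-\infty)=0$ and $\inf\emptyset=+\infty$. For the sequence $(r_n)$ set $c_{j,n}=\frac{2j+1}{2n}$, $J_{j,n}=(c_{j,n}-\frac{r_n}{2},\,c_{j,n}+\frac{r_n}{2})$ for $j=0,\dots,n-1$, and $V_n=\bigcup_{j=0}^{n-1}J_{j,n}$. The uniform $G_\delta$-set corresponding to $(r_n)$ is $S:=\bigcap_{m=1}^\infty\bigcup_{n=m}^\infty V_n$. *)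

(* Defs.v *)
From HB Require Import structures.
From mathcomp Require Import all_boot all_order all_algebra.
From mathcomp Require Import all_classical all_reals all_analysis.
From mathcomp Require Import complex.

Set Implicit Arguments.
Unset Strict Implicit.
Unset Printing Implicit Defensive.

Import Order.TTheory GRing.Theory Num.Theory.
Import numFieldTopology.Exports numFieldNormedType.Exports.

Local Open Scope classical_set_scope.
Local Open Scope ring_scope.

(* The complex numbers over [R] with their Borel sigma-algebra: [(R[i])^o] is
   the library's alias of [R[i]] carrying the topology of the modulus. *)
Notation borelC R := (g_sigma_algebraType (@open (R[i])^o)).

Section capacity.
Variable R : realType.

(* The library norm [`|u|] of [u : R[i]] lives in [R[i]] (as a nonnegative real
   element), hence the projection [Re].  Unlike [ln], the function [lne]
   satisfies [lne 0 = -oo], so the kernel is [+oo] on the diagonal. *)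
Definition log_kernel (z w : R[i]) : \bar R :=
  (- lne (complex.Re `|z - w|)%:E)%E.

Definition energy (mu : {measure set (borelC R) -> \bar R}) : \bar R :=
  (\int[mu]_z \int[mu]_w log_kernel z w)%E.

Definition borel_probabilities_on (X : set R[i]) :
    set (probability (borelC R) R) :=
  [set mu | mu (~` X : set (borelC R)) = 0%E].

(* Meaningful for bounded Borel sets [X] (measures have unspecified values on
   non-measurable sets).  Here [ereal_inf set0 = +oo] and [expeR -oo = 0]. *)
Definition Cap (X : set R[i]) : \bar R :=
  (expeR (- ereal_inf [set energy mu | mu in borel_probabilities_on X]))%E.

End capacity.

Section uniform_Gdelta.
Variables (R : realType) (r : nat -> R).

Definition gd_center (j n : nat) : R := (2 * j%:R + 1) / (2 * n%:R).

Definition gd_interval (j n : nat) : set R :=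
  `]gd_center j n - r n / 2, gd_center j n + r n / 2[%classic.

Definition gd_union (n : nat) : set R := \bigcup_(j in `I_n) gd_interval j n.

Definition uniform_Gdelta : set R :=
  \bigcap_(m in [set m | (1 <= m)%N]) \bigcup_(n in [set n | (m <= n)%N])
    gd_union n.

(* The sequences are indexed by [n >= 1]; the value [r 0] is irrelevant. *)
Definition subexponential_radii : Prop :=
  [/\ forall m n, (1 <= m <= n)%N -> r n <= r m,
      forall n, (1 <= n)%N -> 0 < r n,
      r @ \oo --> (0 : R),
      forall n, (1 <= n)%N -> r n < 1 / n%:R &
      (fun n => `|ln (r n)|) =o_\oo (fun n => n%:R : R)].

Definition stretched_exponential_radii : Prop :=
  exists2 alpha : R, 0 < alpha < 2 &
    forall n, (1 <= n)%N -> r n = expR (- (n%:R `^ alpha)).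

End uniform_Gdelta.

(* Main.v *)
Require Import Defs.
From HB Require Import structures.
From mathcomp Require Import all_boot all_order all_algebra.
From mathcomp Require Import all_classical all_reals all_analysis.
From mathcomp Require Import measurable_realfun complex cyclic.
From mathcomp Require Import zify ring lra.

(** The inclusion of [J `&` S] in [J] gives one inequality.  For the other, a
    probability [mu] on [J] of finite energy is transported to a probability on
    [J `&` S] at the cost of an arbitrarily small increase of energy.

    Everything is phrased with random variables: for [X] on a probability space,
    [lenergy X] is the expectation of [- ln |X - X'|] with [X'] an independent
    copy, and the transported measure is the law of a limit of maps [X_k].

    One step ([redistribution_map], [redistribution_step]).  Cut [0, 1] into [M]
    cells of length [1/M].  A point of a cell is sent next to a centre of some
    [V_n] lying in the same cell, by a contraction which fits the image of the
    cell in [V_n].  Each cell must offer many centres that are pairwise distinct: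
    with [L = M ^ K.+1] and [n = M m], [1 <= m <= L], the centres of [V_n] in a
    cell are copies of the fractions [(2 i + 1) / (2 m)], and the number of these
    in lowest terms is a sum of totients, hence at least [L ^ 2 / 12]
    ([reduced_centers_ge]).  Which centre is used is decided by a label of the
    sample point whose fibres have probability at most [12 / L ^ 2].

    Why the energy hardly increases ([lenergy_redistribution]).  Compare
    [- ln |Y - Y'|] with [- ln |X - X'|].
    - Points at distance at least [eta] move by [O(1/M)], so the loss is small
      for [M] large; for intermediate distances the loss is at most [ln 2], on an
      event of small probability.
    - Points at distance [O(1/M)] sent to distinct centres end up at distance
      at least a power of [1/M], since centres are rationals with denominators
      polynomial in [M].  The loss is [O(ln M)] times the probability that
      [|X - X'| = O(1/M)], which tends to [0] because the energy is finite
      ([close_pairs_small]).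
    - Points sharing a centre lose the logarithm of the contraction ratio.  The
      radii allow a loss of order [M ^ (2 K + 1)], on an event of probability at
      most [12 / M ^ (2 K + 2)].
    So the radii [exp (- n ^ alpha)] are large enough when [alpha < 2]: this is
    the only place where the size of [r] matters, through [thick_radii].

    Limit ([redistribution_limit]).  Iterate with errors [e / 2 ^ k.+1], the [k]-th
    map being so close to its predecessor that the successive balls around the
    images are nested; each of them lies in some [V_n] with [n >= k], so the
    limit lies in [S], and Fatou's lemma bounds its energy.  Before starting, [J]
    is slightly contracted towards its middle to leave room for the moves. *)

Set Implicit Arguments.
Unset Strict Implicit.
Unset Printing Implicit Defensive.

Import Order.TTheory GRing.Theory Num.Theory.
Import numFieldTopology.Exports numFieldNormedType.Exports.

(** * Counting fractions in lowest terms *)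

(** Sum the identity [\sum_(d %| n) totient d = n] over [n <= L] and exchange the
    two summations. *)
Lemma sum_totient_divn L :
  \sum_(1 <= d < L.+1) totient d * (L %/ d) = \sum_(1 <= n < L.+1) n.
Proof.
elim: L => [|L IH]; first by rewrite !big_geq.
rewrite [RHS]big_nat_recr //= -IH.
under eq_big_nat => d /andP[d0 _].
  have -> : L.+1 %/ d = L %/ d + (d %| L.+1).
    by rewrite divnS // addnC.
  over.
under eq_bigr do rewrite mulnDr.
rewrite big_split /= big_nat_recr //= divn_small // muln0 addn0; congr addn.
rewrite -[RHS]sum_totient_dvd -(big_mkord (fun d => d %| L.+1) totient).
rewrite [RHS]big_mkcond [RHS]big_ltn //= add0n.
by apply: eq_big_nat => d _; case: ifP => _; rewrite ?muln1 ?muln0.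
Qed.

Lemma totient_leq n : totient n <= n.
Proof.
rewrite totient_count_coprime -[leqRHS](subn0 n) -[leqRHS]muln1.
rewrite -sum_nat_const_nat; apply: leq_sum => d _; exact: leq_b1.
Qed.

(** In [sum_totient_divn] the terms with [d <= L / 4] contribute at most a half of
    the total; in the others the cofactor [L %/ d] is at most [3]. *)
Lemma sum_totient_ge L : L ^ 2 <= 12 * \sum_(1 <= d < L.+1) totient d.
Proof.
set Q := L %/ 4.
have QL : Q <= L by rewrite leq_div.
have gauss : 2 * \sum_(1 <= n < L.+1) n = L * L.+1.
  elim: L {Q QL} => [|L IH]; first by rewrite big_geq.
  by rewrite big_nat_recr //= mulnDr IH; lia.
rewrite -sum_totient_divn (@big_cat_nat _ _ _ Q.+1) //= in gauss.
have low : \sum_(1 <= d < Q.+1) totient d * (L %/ d) <= Q * L.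
  rewrite -[X in X * L](subn1 Q.+1) -sum_nat_const_nat.
  rewrite big_nat_cond [leqRHS]big_nat_cond.
  apply: leq_sum => d; rewrite andbT => /andP[d0 _].
  rewrite (leq_trans _ (leq_trunc_div L d)) // mulnC leq_mul2l totient_leq.
  by rewrite orbT.
have high : \sum_(Q.+1 <= d < L.+1) totient d * (L %/ d)
    <= 3 * \sum_(1 <= d < L.+1) totient d.
  rewrite (@big_cat_nat _ _ _ Q.+1 1) //= mulnDr.
  rewrite (leq_trans _ (leq_addl _ _)) // big_distrr /=.
  rewrite big_nat_cond [leqRHS]big_nat_cond.
  apply: leq_sum => d; rewrite andbT => /andP[Qd _].
  rewrite mulnC leq_mul2r -ltnS ltn_divLR; last lia.
  by apply/orP; right; rewrite /Q in Qd; lia.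
have : Q * 4 <= L by exact: leq_trunc_div.
nia.
Qed.

Definition odd_coprimes m := [seq i <- iota 0 m | coprime (2 * i + 1) m].

(** [odd_coprimes m] lists the [i] such that [(2 i + 1) / (2 m)] is in lowest
    terms.  A [d < m] coprime to [m] is made odd, if necessary, by adding [m]. *)
Lemma totient_le_odd_coprimes m : totient m <= size (odd_coprimes m).
Proof.
have E : totient m = size [seq d <- iota 0 m | coprime m d].
  rewrite totient_count_coprime size_filter -sum1_count -big_mkcond /= /index_iota.
  by rewrite subn0 big_mkcond /=; apply: eq_bigr => d _; case: ifP.
pose f d := if odd d then d./2 else (d + m)./2.
rewrite E -(size_map f); apply: uniq_leq_size.
  rewrite map_inj_in_uniq ?filter_uniq ?iota_uniq // => d e.
  rewrite !mem_filter !mem_iota !add0n /= /f => /andP[cd dm] /andP[ce em].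
  (* If [m] were even, a number coprime to [m] would be odd. *)
  have aux x : ~~ odd x -> coprime m x -> odd m.
    move=> ox; apply: contraTT => om.
    have : 2 %| gcdn m x by rewrite dvdn_gcd !dvdn2 om ox.
    by rewrite /coprime; case: eqP => // ->.
  have := odd_double_half (d + m); have := odd_double_half (e + m).
  have := odd_double_half d; have := odd_double_half e.
  rewrite !oddD.
  case: ifP => od; case: ifP => oe.
  - by lia.
  - by rewrite (aux _ (negbT oe) ce) /=; lia.
  - by rewrite (aux _ (negbT od) cd) /=; lia.
  - by lia.
move=> j /mapP[d]; rewrite !mem_filter !mem_iota !add0n /= => /andP[cd dm] ->.
rewrite /f; case: ifP => od.
  have E2 : 2 * d./2 + 1 = d by have := odd_double_half d; lia.
  by rewrite E2 coprime_sym cd; lia.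
have om : odd m.
  apply: contraTT cd => om.
  apply/negP => /eqP g1.
  have : 2 %| gcdn m d by rewrite dvdn_gcd !dvdn2 om od.
  by rewrite g1.
have E2 : 2 * (d + m)./2 + 1 = d + m.
  by have := odd_double_half (d + m); rewrite oddD od om /=; lia.
by rewrite E2 /coprime gcdnC gcdnDr -/(coprime m d) cd; lia.
Qed.

(** The pairs [(m, i)] such that [(2 i + 1) / (2 m)] is in lowest terms. *)
Definition reduced_centers L :=
  flatten [seq [seq (m, i) | i <- odd_coprimes m] | m <- iota 1 L].

Lemma mem_reduced_centers L m i : (m, i) \in reduced_centers L ->
  [/\ 0 < m <= L, i < m & coprime (2 * i + 1) m].
Proof.
move=> /flatten_mapP[m' + /mapP[i']].
rewrite mem_iota mem_filter mem_iota /= add0n => Hm /andP[co im] [-> ->].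
by split => //; lia.
Qed.

Lemma uniq_reduced_centers L : uniq (reduced_centers L).
Proof.
apply: allpairs_uniq_dep; first exact: iota_uniq.
  by move=> m _; apply/filter_uniq/iota_uniq.
by move=> [m i] [m' i'] /= _ _ [-> ->].
Qed.

Lemma reduced_centers_ge L : L ^ 2 <= 12 * size (reduced_centers L).
Proof.
apply: leq_trans (sum_totient_ge L) _; rewrite leq_mul2l /=.
rewrite size_flatten /shape -map_comp sumnE big_map.
rewrite /index_iota subn1 /=; apply: leq_sum => m _.
by rewrite /= size_map totient_le_odd_coprimes.
Qed.

(** The cross-multiplied form of
    [(2 (a m + i) + 1) / (2 m) = (2 (a' m' + i') + 1) / (2 m')]: both fractions are
    in lowest terms, so their denominators agree. *)
Lemma reduced_center_inj m i m' i' a a' :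
  0 < m -> 0 < m' -> i < m -> i' < m' ->
  coprime (2 * i + 1) m -> coprime (2 * i' + 1) m' ->
  (2 * (a * m + i) + 1) * m' = (2 * (a' * m' + i') + 1) * m ->
  [/\ a = a', m = m' & i = i'].
Proof.
move=> m0 m0' im im' co co' E.
have aux b n j : coprime (2 * j + 1) n -> coprime n (2 * (b * n + j) + 1).
  have -> : 2 * (b * n + j) + 1 = 2 * b * n + (2 * j + 1) by lia.
  by rewrite /coprime gcdnMDl gcdnC.
have mm' : m = m'.
  apply/eqP; rewrite eqn_dvd -(Gauss_dvdr m' (aux a m i co)) E dvdn_mull //=.
  by rewrite -(Gauss_dvdr m (aux a' m' i' co')) -E dvdn_mull.
subst m'; move/eqP: E; rewrite eqn_pmul2r // => /eqP E.
have E2 : a * m + i = a' * m + i' by lia.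
have Ea : a = a'.
  move/(congr1 (divn^~ m)): E2.
  by rewrite /= !divnMDl // !divn_small // !addn0.
by subst a'; split => //; lia.
Qed.

Local Open Scope classical_set_scope.
Local Open Scope ring_scope.

(** * Logarithmic energy of a random variable *)

Section logk.
Context {R : realType}.
Implicit Types s t : R.

Definition logk t : \bar R := (- lne `|t|%:E)%E.

Lemma logk0 : logk 0 = +oo%E.
Proof. by rewrite /logk normr0 le0_lneNy. Qed.

Lemma logkE t : t != 0 -> logk t = (- ln `|t|)%:E.
Proof. by move=> t0; rewrite /logk lne_EFin ?normr_gt0// EFinN. Qed.

Lemma logk_ge0 t : `|t| <= 1 -> (0 <= logk t)%E.
Proof. by move=> t1; rewrite /logk leeNr oppe0 lne_le0 lee_fin. Qed.

Lemma le_logk s t : `|s| <= `|t| -> (logk t <= logk s)%E.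
Proof.
have [->|s0] := eqVneq s 0; first by rewrite logk0 leey.
move=> st; have t0 : t != 0.
  by rewrite -normr_gt0 (lt_le_trans _ st)// normr_gt0.
by rewrite !logkE// lee_fin lerN2 ler_ln// posrE normr_gt0.
Qed.

Lemma measurable_logk : measurable_fun setT logk.
Proof.
rewrite (_ : logk = fun t => if t == 0 then +oo%E else (- ln `|t|)%:E); last first.
  by apply/funext => t; case: eqVneq => [->|/logkE//]; exact: logk0.
apply: measurable_fun_ifT => //.
  by apply: measurable_fun_eqr => //; exact: measurable_cst.
apply/measurable_EFinP; apply: measurableT_comp => //.
by apply: measurableT_comp; [exact: measurable_ln|exact: normr_measurable].
Qed.

End logk.

Section lenergy.
Context {R : realType} {d} {T : measurableType d} (P : probability T R).
Implicit Types X Y : T -> R.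
Local Open Scope ereal_scope.

Definition pdist X (p : T * T) : R := (X p.1 - X p.2)%R.

Definition lenergy X : \bar R := \int[P \x P]_p logk (pdist X p).

Lemma measurable_pdist X : measurable_fun setT X ->
  measurable_fun setT (pdist X).
Proof.
move=> mX; apply: measurable_funB.
  by apply: measurableT_comp => //; exact: measurable_fst.
by apply: measurableT_comp => //; exact: measurable_snd.
Qed.

Lemma measurable_logk_pdist X : measurable_fun setT X ->
  measurable_fun setT (logk \o pdist X).
Proof.
by move=> mX; apply: measurableT_comp; [exact: measurable_logk|exact: measurable_pdist].
Qed.

Lemma pdist_le1 X : (forall w, 0 <= X w <= 1)%R -> forall p, (`|pdist X p| <= 1)%R.
Proof.
move=> X01 p; rewrite /pdist ler_norml.
by have /andP[? ?] := X01 p.1; have /andP[? ?] := X01 p.2; apply/andP; split; lra.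
Qed.

Definition close_pairs X t : set (T * T) := [set p | `|pdist X p| <= t]%R.

Lemma measurable_close_pairs X t : measurable_fun setT X -> measurable (close_pairs X t).
Proof.
move=> mX.
have m : measurable_fun setT (Num.norm \o pdist X).
  by apply: measurableT_comp; [exact: normr_measurable|exact: measurable_pdist].
rewrite (_ : close_pairs X t = setT `&` ((Num.norm \o pdist X) @^-1` `]-oo, t]%classic)).
  exact: m.
by rewrite setTI; apply/seteqP; split => p /=; rewrite in_itv.
Qed.

Lemma prod_probability_setT : (P \x P) setT = 1.
Proof.
rewrite -setXTT product_measure1E//.
have E : P setT = 1 by exact: probability_setT.
by rewrite -[RHS]mul1e; congr (_ * _).
Qed.

(** A finite energy controls the close pairs at a logarithmic rate: on
    [close_pairs X t] the integrand is at least [- ln t], and by dominated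
    convergence its integral over the pairs at distance at most [D] tends to [0]
    with [D], the diagonal being negligible. *)
Lemma close_pairs_small X : measurable_fun setT X -> (forall w, 0 <= X w <= 1)%R ->
  lenergy X < +oo -> forall e : R, (0 < e)%R ->
  exists2 D : R, (0 < D < 1)%R &
    forall t, (0 < t <= D)%R -> (- ln t)%:E * (P \x P) (close_pairs X t) <= e%:E.
Proof.
move=> mX X01 fin e e0.
pose f := logk \o pdist X.
have f0 p : 0 <= f p by apply/logk_ge0/pdist_le1.
have mf : measurable_fun setT f by exact: measurable_logk_pdist.
have If : (P \x P).-integrable setT f.
  apply/integrableP; split=> //.
  by under eq_integral do rewrite gee0_abs ?f0//.
pose A n := close_pairs X (n.+2%:R^-1)%R.
have mA n : measurable (A n) by exact: measurable_close_pairs.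
pose g n := f \_ (A n).
have mg n : measurable_fun setT (g n).
  apply/(measurable_restrictT _ (mA n)); exact: measurable_funTS.
have gf : {ae P \x P, forall p, setT p -> g ^~ p @ \oo --> (cst 0) p}.
  apply: filterS (integrable_ae measurableT If) => p /(_ I) fp _.
  have [D0|D0] := eqVneq (pdist X p) 0%R.
    by move: fp; rewrite /f /= D0 logk0.
  have D1 : (0 < `|pdist X p|)%R by rewrite normr_gt0.
  apply: cvg_near_cst; near=> n; rewrite /g patchE memNset//=.
  apply/negP; rewrite -ltNge.
  have nlt : (n.+1%:R^-1 < `|pdist X p|)%R.
    by near: n; exact: (near_infty_natSinv_lt (PosNum D1)).
  by apply: lt_trans nlt; rewrite ltf_pV2 ?posrE// ltr_nat.
have gle : {ae P \x P, forall p n, setT p -> `|g n p| <= f p}.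
  apply: nearW => p n _; rewrite /g patchE; case: ifP => _.
    by rewrite gee0_abs.
  by rewrite abse0.
have [_ _] := dominated_convergence measurableT mg (measurable_cst _) gf If gle.
rewrite integral0 => /fine_cvgP[gfin /cvgrPdist_lt /(_ _ e0) glt].
have [n [/= gn gne]] := filter_ex (filterI gfin glt).
exists (n.+2%:R^-1)%R.
  by rewrite invr_gt0 ltr0n /= invf_lt1 ?ltr0n// ltr1n.
move=> t /andP[t0 tD].
have CA : close_pairs X t `<=` A n by move=> p /= pt; exact: le_trans tD.
have mC := measurable_close_pairs t mX.
have lnt0 : (0 <= - ln t)%R.
  by rewrite oppr_ge0 ln_le0// (le_trans tD)// invf_le1 ?ltr0n// ler1n.
rewrite -integral_cst//.
apply: (@le_trans _ _ (\int[P \x P]_(p in A n) f p)).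
  apply: (@le_trans _ _ (\int[P \x P]_(p in close_pairs X t) f p)).
    apply: ge0_le_integral => //=.
      exact: measurable_funTS.
    move=> p pt; rewrite -[leLHS](_ : logk t = _); last first.
      by rewrite logkE ?gt_eqF// gtr0_norm.
    by apply: le_logk; rewrite (gtr0_norm t0).
  apply: ge0_subset_integral => //; exact: measurable_funTS.
have -> : \int[P \x P]_(p in A n) f p = \int[P \x P]_p g n p by rewrite integral_mkcond.
move: gne; rewrite sub0r normrN => gne.
rewrite -(fineK gn) lee_fin (le_trans (ler_norm _))// ltW//.
Unshelve. all: by end_near. Qed.

End lenergy.

(** * Energy increase under a redistribution *)

(** The loss incurred by a pair of points when each moves by at most [u / 2].  If
    the pair is kept together it is contracted by [kappa]; otherwise its points
    end up at least [sigma] apart, which is used when they were within [2 u], the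
    triangle inequality being better for the pairs further apart. *)
Lemma logk_redistribution (R : realType) (x x' y y' u eta e1 sigma kappa : R)
    (same : bool) :
  `|x - x'| <= 1 -> 0 < u -> 0 < eta -> u <= eta / 2 -> - ln (1 - u / eta) <= e1 ->
  0 < sigma <= 1 -> 0 < kappa <= 1 ->
  `|y - x| <= u / 2 -> `|y' - x'| <= u / 2 ->
  (if same then `|y - y'| = kappa * `|x - x'| else sigma <= `|y - y'|) ->
  (logk (y - y') <= logk (x - x') +
    (e1 + ((`|x - x'| <= eta)%R%:R * ln 2 +
    ((`|x - x'| <= u *+ 2)%R%:R * - ln sigma + same%:R * - ln kappa)))%R%:E)%E.
Proof.
move=> D1 u0 eta0 ueta e1ge /andP[s0 s1] /andP[k0 k1] yx yx' H.
have [->|xx'] := eqVneq (x - x') 0; first by rewrite logk0 leey.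
have D0 : 0 < `|x - x'| by rewrite normr_gt0.
have lnD : ln `|x - x'| <= 0 by rewrite ln_le0.
have ln20 : 0 <= ln (2 : R) by rewrite ln_ge0// ler1n.
have lns : ln sigma <= 0 by rewrite ln_le0.
have lnk : ln kappa <= 0 by rewrite ln_le0.
have ue : u / eta <= 2^-1 by rewrite ler_pdivrMr// mulrC.
have ue0 : 0 < u / eta by rewrite divr_gt0.
have e10 : 0 <= e1 by apply: le_trans e1ge; rewrite oppr_ge0 ln_le0//; lra.
suff [yy' K] : 0 < `|y - y'| /\ - ln `|y - y'| <= - ln `|x - x'| +
    (e1 + ((`|x - x'| <= eta)%R%:R * ln 2 +
    ((`|x - x'| <= u *+ 2)%R%:R * - ln sigma + same%:R * - ln kappa))).
  by rewrite !logkE -?normr_gt0// -EFinD lee_fin.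
have i1 : 0 <= (`|x - x'| <= eta)%R%:R * ln (2 : R) by rewrite mulr_ge0.
have i2 : 0 <= (`|x - x'| <= u *+ 2)%R%:R * - ln sigma by rewrite mulr_ge0// oppr_ge0.
case: same H => [H|H].
  split; first by rewrite H mulr_gt0.
  rewrite H lnM ?posrE// mul1r; lra.
rewrite mul0r addr0.
split; first exact: lt_le_trans H.
have [near|far] := leP `|x - x'| (u *+ 2).
  rewrite mul1r.
  have : ln sigma <= ln `|y - y'| by rewrite ler_ln// posrE// (lt_le_trans _ H).
  lra.
rewrite mul0r addr0.
have dist : `|x - x'| - u <= `|y - y'|.
  have -> : x - x' = (y - y') - (y - x) + (y' - x') by ring.
  rewrite lerBlDr (le_trans (ler_normD _ _))// (splitr u) addrA.
  by apply: lerD => //; rewrite (le_trans (ler_normB _ _))// lerD2l.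
have [near'|far'] := leP `|x - x'| eta.
  rewrite mul1r.
  have : ln (`|x - x'| / 2) <= ln `|y - y'|.
    rewrite ler_ln ?posrE ?divr_gt0//; first by rewrite (le_trans _ dist)//; lra.
    by rewrite (lt_le_trans _ H).
  rewrite lnM ?posrE ?invr_gt0// lnV ?posrE//; lra.
rewrite mul0r addr0.
have : ln (`|x - x'| * (1 - u / eta)) <= ln `|y - y'|.
  rewrite ler_ln ?posrE; last 2 first.
  - by rewrite mulr_gt0//; lra.
  - by rewrite (lt_le_trans _ H).
  apply: le_trans dist; rewrite mulrBr mulr1 lerB// mulrCA.
  by rewrite ler_peMr ?(ltW u0)// ler_pdivlMr// mul1r ltW.
rewrite lnM ?posrE//; last lra.
lra.
Qed.

Section lenergy_redistribution.
Context {R : realType} {d} {T : measurableType d} (P : probability T R).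
Local Open Scope ereal_scope.

(** Condition on the first sample point: whatever its label [k], the second one has
    label [k] with probability at most [tau]. *)
Lemma same_index_small (b : T -> nat) (tau : R) :
  measurable_fun setT b -> (forall k, P [set w | b w = k] <= tau%:E) ->
  measurable [set p : T * T | b p.1 = b p.2] /\
  (P \x P) [set p : T * T | b p.1 = b p.2] <= tau%:E.
Proof.
move=> mb btau.
have mk k : measurable [set w | b w = k].
  by rewrite -[X in measurable X]setTI; exact: (mb measurableT [set k]).
have mS : measurable [set p : T * T | b p.1 = b p.2].
  rewrite (_ : [set p | _] = \bigcup_k ([set w | b w = k] `*` [set w | b w = k])).
    by apply: bigcupT_measurable => k; exact: measurableX.
  apply/seteqP; split => [[w w'] /= E|[w w'] [k _ [/= -> ->]]//].
  by exists (b w).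
split => //.
rewrite /product_measure1.
apply: (@le_trans _ _ (\int[P]_w (cst tau%:E w))).
  apply: ge0_le_integral => //=.
    exact: measurable_fun_xsection.
  move=> w _; rewrite (_ : xsection _ w = [set w' | b w' = b w]); first exact: btau.
  by apply/seteqP; split=> w' /=; rewrite xsectionP/= => /esym.
rewrite integral_cst// -[leRHS]mule1; apply: lee_pmul => //; last exact: probability_le1.
by rewrite (le_trans _ (btau 0%N)).
Qed.

Lemma integral_indic_cst (A : set (T * T)) (c : R) : measurable A -> (0 <= c)%R ->
  \int[P \x P]_p (\1_A p * c)%R%:E = c%:E * (P \x P) A.
Proof.
move=> mA c0; under eq_integral do rewrite EFinM muleC.
rewrite ge0_integralZl//; last by apply/measurable_EFinP; exact: measurable_indic.
by rewrite -[in RHS](setIT A) -integral_indic// setIT.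
Qed.

Lemma lenergy_redistribution (X Y : T -> R) (b : T -> nat) (u eta e1 sigma kappa tau : R) :
  measurable_fun setT X -> measurable_fun setT Y -> measurable_fun setT b ->
  (forall w, 0 <= X w <= 1)%R -> (forall w, 0 <= Y w <= 1)%R ->
  (0 < u)%R -> (0 < eta)%R -> (u <= eta / 2)%R -> (- ln (1 - u / eta) <= e1)%R ->
  (0 < sigma <= 1)%R -> (0 < kappa <= 1)%R ->
  (forall w, `|Y w - X w| <= u / 2)%R ->
  (forall w w', (b w = b w' /\ `|Y w - Y w'| = kappa * `|X w - X w'|)%R \/
     (sigma <= `|Y w - Y w'|)%R) ->
  (forall k, P [set w | b w = k] <= tau%:E) ->
  lenergy P Y <= lenergy P X + (e1%:E + ((ln 2)%:E * (P \x P) (close_pairs X eta) +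
    ((- ln sigma)%R%:E * (P \x P) (close_pairs X (u *+ 2)%R) + (- ln kappa * tau)%R%:E))).
Proof.
move=> mX mY mb X01 Y01 u0 eta0 ueta e1ge s01 k01 YX sep btau.
have [mS Stau] := same_index_small mb btau.
set S := [set p | _] in mS Stau.
pose C1 := close_pairs X eta; pose C2 := close_pairs X (u *+ 2)%R.
have mC1 : measurable C1 by exact: measurable_close_pairs.
have mC2 : measurable C2 by exact: measurable_close_pairs.
have ln20 : (0 <= ln (2 : R))%R by rewrite ln_ge0// ler1n.
have lns : (0 <= - ln sigma)%R by case/andP: s01 => ? ?; rewrite oppr_ge0 ln_le0.
have lnk : (0 <= - ln kappa)%R by case/andP: k01 => ? ?; rewrite oppr_ge0 ln_le0.
have e10 : (0 <= e1)%R.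
  apply: le_trans e1ge; rewrite oppr_ge0 ln_le0//.
  have : (0 < u / eta)%R by rewrite divr_gt0.
  lra.
have bound p : logk (pdist Y p) <= logk (pdist X p) + (e1%:E + ((\1_C1 p * ln 2)%R%:E +
    ((\1_C2 p * - ln sigma)%R%:E + (\1_S p * - ln kappa)%R%:E))).
  rewrite -!EFinD !indicE.
  have inC t : (p \in close_pairs X t) = (`|X p.1 - X p.2| <= t)%R.
    by apply/idP/idP => [/set_mem|?]; [|exact/mem_set].
  rewrite !inC.
  have [close|faraway] := sep p.1 p.2.
    have -> : p \in S by apply/mem_set; case: close.
    by apply: (@logk_redistribution _ _ _ _ _ _ _ _ _ _ true) => //;
      [exact: pdist_le1|case: close].
  apply: le_trans (@logk_redistribution _ _ _ _ _ _ _ e1 _ _ false (pdist_le1 X01 p)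
    u0 eta0 ueta e1ge s01 k01 (YX p.1) (YX p.2) faraway) _.
  by rewrite leeD2l// lee_fin !lerD2l mul0r mulr_ge0.
have mi (A : set (T * T)) (c : R) : measurable A ->
    measurable_fun setT (fun p => (\1_A p * c)%R%:E).
  move=> mA; apply/measurable_EFinP/measurable_funM => //; exact: measurable_indic.
have E1 : (P \x P) setT = 1 by exact: prod_probability_setT.
have mS3 := emeasurable_funD (mi _ (- ln sigma)%R mC2) (mi _ (- ln kappa)%R mS).
have mS2 := emeasurable_funD (mi _ (ln 2) mC1) mS3.
have mS1 : measurable_fun setT _ := emeasurable_funD (measurable_cst e1%:E) mS2.
have ni (A : set (T * T)) (c : R) p : (0 <= c)%R -> 0 <= (\1_A p * c)%R%:E.
  by move=> c0; rewrite lee_fin mulr_ge0.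
apply: (@le_trans _ _ (\int[P \x P]_p (logk (pdist X p) + (e1%:E + ((\1_C1 p * ln 2)%R%:E +
    ((\1_C2 p * - ln sigma)%R%:E + (\1_S p * - ln kappa)%R%:E)))))).
  apply: ge0_le_integral => //=.
  - by move=> p _; apply/logk_ge0/pdist_le1.
  - exact: measurable_logk_pdist.
  - by apply: emeasurable_funD => //; exact: measurable_logk_pdist.
have mL := measurable_logk_pdist mX.
have nL p : setT p -> 0 <= logk (pdist X p) by move=> _; apply/logk_ge0/pdist_le1.
have n1 p : setT p -> 0 <= (\1_C1 p * ln (2 : R))%R%:E by move=> _; rewrite lee_fin mulr_ge0.
have n2 p : setT p -> 0 <= (\1_C2 p * - ln sigma)%R%:E by move=> _; rewrite lee_fin mulr_ge0.
have n3 p : setT p -> 0 <= (\1_S p * - ln kappa)%R%:E by move=> _; rewrite lee_fin mulr_ge0.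
have n23 p (h : setT p) := adde_ge0 (n2 p h) (n3 p h).
have n123 p (h : setT p) := adde_ge0 (n1 p h) (n23 p h).
have e1E (p : T * T) : setT p -> 0 <= cst e1%:E p by move=> _; rewrite lee_fin.
have ne123 (p : T * T) (h : setT p) := adde_ge0 (e1E p h) (n123 p h).
rewrite (ge0_integralD (P \x P) measurableT nL mL ne123 mS1) leeD2l//.
rewrite (ge0_integralD (P \x P) measurableT e1E (measurable_cst _) n123 mS2).
have -> : \int[P \x P]_p cst e1%:E p = e1%:E.
  by rewrite integral_cst// -[RHS]mule1; congr (_ * _).
rewrite leeD2l//.
rewrite (ge0_integralD (P \x P) measurableT n1 (mi _ _ mC1) n23 mS3).
rewrite (ge0_integralD (P \x P) measurableT n2 (mi _ _ mC2) n3 (mi _ _ mS)).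
rewrite integral_indic_cst// leeD2l//.
rewrite !integral_indic_cst// leeD2l// EFinM.
by apply: lee_pmul.
Qed.

End lenergy_redistribution.

(** * Choice of the centres and the redistribution map *)

Section measurable_nat_index.
Context {R : realType} {d} {T : measurableType d}.

Lemma measurable_nat_fibers (N : T -> nat) :
  (forall k, measurable [set w | N w = k]) -> measurable_fun setT N.
Proof.
move=> mN _ Y _; rewrite setTI.
rewrite (_ : N @^-1` Y = \bigcup_(k in Y) [set w | N w = k]).
  by apply: bigcup_measurable => k _.
by apply/seteqP; split => [w /= ?|w [k Yk /= ->]//]; exists (N w).
Qed.

Lemma measurable_truncn (f : T -> R) : measurable_fun setT f ->
  measurable_fun setT (fun w => Num.truncn (f w)).
Proof.
move=> mf; apply: measurable_nat_fibers.
have mle k : measurable [set w | (Num.truncn (f w) <= k)%N].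
  rewrite (_ : [set w | _] = setT `&` f @^-1` `]-oo, k.+1%:R[%classic).
    by apply: mf => //; exact: measurable_itv.
  by rewrite setTI; apply/seteqP; split => w /=; rewrite in_itv/= truncn_le_nat.
case=> [|k].
  rewrite (_ : [set w | _] = [set w | (Num.truncn (f w) <= 0)%N])//.
  by apply/seteqP; split => w /=; rewrite leqn0 => /eqP.
rewrite (_ : [set w | _] = [set w | (Num.truncn (f w) <= k.+1)%N] `\`
                           [set w | (Num.truncn (f w) <= k)%N]).
  exact: measurableD.
apply/seteqP; split => w /=; first by move=> ->; rewrite leqnn; split=> //; rewrite ltnn.
by move=> [h1 /negP h2]; apply/eqP; rewrite eqn_leq h1 ltnNge.
Qed.

(** A choice among countably many measurable functions, made by a measurable
    index, is measurable. *)
Lemma measurable_fun_nat_param (N : T -> nat) (F : nat -> T -> R) :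
  measurable_fun setT N -> (forall k, measurable_fun setT (F k)) ->
  measurable_fun setT (fun w => F (N w) w).
Proof.
move=> mN mF _ Y mY; rewrite setTI.
rewrite (_ : _ @^-1` Y = \bigcup_k ((setT `&` N @^-1` [set k]) `&` (setT `&` F k @^-1` Y))).
  by apply: bigcupT_measurable => k; apply: measurableI; [exact: mN|exact: mF].
apply/seteqP; split => [w /= ?|w [k _ /= [[_ /= ->] [_]]]//].
by exists (N w).
Qed.

End measurable_nat_index.

Section center_family.
Context {R : realType}.

(** The difference of two distinct fractions is at least the inverse of a common
    denominator. *)
Lemma gd_center_dist (j j' m m' M L : nat) : (0 < M)%N -> (0 < m <= L)%N -> (0 < m' <= L)%N ->
  ((2 * j + 1) * m')%N != ((2 * j' + 1) * m)%N ->
  (2 * M%:R * L%:R ^+ 2)^-1 <= `|gd_center R j (M * m) - gd_center R j' (M * m')|.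
Proof.
move=> M0 /andP[m0 mL] /andP[m0' mL'] ne.
have mR : 0 < m%:R :> R by rewrite ltr0n.
have mR' : 0 < m'%:R :> R by rewrite ltr0n.
have MR : 0 < M%:R :> R by rewrite ltr0n.
have LR : 0 < L%:R :> R by rewrite ltr0n (leq_trans m0).
rewrite /gd_center !natrM.
have -> : (2 * j%:R + 1) / (2 * (M%:R * m%:R)) - (2 * j'%:R + 1) / (2 * (M%:R * m'%:R))
   = (((2 * j + 1) * m')%N%:R - ((2 * j' + 1) * m)%N%:R) / (2 * M%:R * (m%:R * m'%:R)) :> R.
  by rewrite !natrM !natrD ?natrM; field; rewrite !gt_eqF.
have ge1 : 1 <= `|((2 * j + 1) * m')%N%:R - ((2 * j' + 1) * m)%N%:R| :> R.
  by case: (ltngtP ((2 * j + 1) * m')%N ((2 * j' + 1) * m)%N) ne => // h _;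
    [rewrite distrC|]; rewrite -natrB ?(ltnW h)// normr_nat ler1n subn_gt0.
have d0 : 0 < 2 * M%:R * (m%:R * m'%:R) :> R by rewrite !mulr_gt0.
rewrite normrM normfV (gtr0_norm d0).
apply: (@le_trans _ _ (2 * M%:R * (m%:R * m'%:R))^-1); last first.
  by rewrite ler_peMl// invr_ge0 ltW.
rewrite lef_pV2 ?posrE ?mulr_gt0 ?exprn_gt0//.
by rewrite ler_wpM2l ?mulr_ge0// expr2 ler_pM// ler_nat.
Qed.

Lemma gd_center_cell (a i m M : nat) (x : R) : (0 < M)%N -> (i < m)%N ->
  a%:R <= M%:R * x < a.+1%:R ->
  `|gd_center R (a * m + i) (M * m) - x| <= M%:R^-1.
Proof.
move=> M0 im /andP[ax xa].
have mR : 0 < m%:R :> R by rewrite ltr0n (leq_ltn_trans _ im).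
have MR : 0 < M%:R :> R by rewrite ltr0n.
rewrite -(ler_pM2l MR) -{1}(gtr0_norm MR) -normrM mulrBr mulfV ?gt_eqF//.
have -> : M%:R * gd_center R (a * m + i) (M * m) = a%:R + (2 * i%:R + 1) / (2 * m%:R).
  by rewrite /gd_center natrD !natrM; field; rewrite !gt_eqF.
have q0 : 0 <= (2 * i%:R + 1) / (2 * m%:R) :> R by rewrite divr_ge0// ?addr_ge0 ?mulr_ge0.
have q1 : (2 * i%:R + 1) / (2 * m%:R) <= 1 :> R.
  rewrite ler_pdivrMr ?mulr_gt0// mul1r -natr1E.
  by rewrite -(natrM _ 2) -(natrM _ 2 m) -(natrD _ _ 1) ler_nat; lia.
rewrite -natr1 in xa; rewrite ler_norml; apply/andP; split; lra.
Qed.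

End center_family.

(** The requirement on the radii: a loss of [M ^ (2 K + 1)] is affordable on
    an event of probability of order [M ^ - (2 K + 2)], which is what the centres
    of the [V_n] with [M <= n <= M ^ K.+2] provide. *)
Definition thick_radii {R : realType} (r : nat -> R) (K : nat) : Prop :=
  \forall M \near \oo, forall n, (M <= n <= M ^ K.+2)%N ->
    expR (- (M%:R ^+ (K.*2.+1))) <= r n.

(** Source of labels.  They may depend on the random variables of interest, so the
    same space serves at all steps of the construction. *)
Definition splittable {R : realType} {d} {T : measurableType d} (P : probability T R) :=
  forall N, (0 < N)%N -> exists b : T -> nat, [/\ measurable_fun setT b,
    forall w, (b w < N)%N & forall k, (P [set w | b w = k] <= (N%:R^-1)%:E)%E].

(** A half of the lower bound of [gd_center_dist] for [L = M ^ K.+1]; the other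
    half absorbs the lengths of the images of the cells. *)
Definition center_gap (R : realType) (K M : nat) : R := (4 * M%:R ^+ (K.*2 + 3))^-1.

(** A cell, of length [1 / M], is contracted to the length
    [center_gap K M * expR (- M ^ (2 K + 1))], small with respect both to the
    distance between centres and to the radii. *)
Definition shrinking_ratio (R : realType) (K M : nat) : R :=
  center_gap R K M * expR (- (M%:R ^+ (K.*2.+1))) * M%:R.

Section redistribution_map.
Context {R : realType} {d} {T : measurableType d} (P : probability T R).

(** [Y] sends the cell [a] to the neighbourhood of the centre designated by [a] and
    the label [b], the middle of the cell going to the centre itself.  The label
    alone bounds the probability that two sample points share a centre. *)
Lemma redistribution_map (r : nat -> R) (K M : nat) (X : T -> R) :
  splittable P -> (0 < M)%N ->
  (forall n, (M <= n <= M ^ K.+2)%N -> expR (- (M%:R ^+ (K.*2.+1))) <= r n) ->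
  measurable_fun setT X -> (forall w, 0 <= X w < 1) ->
  exists Y : T -> R, exists b : T -> nat,
    [/\ measurable_fun setT Y, measurable_fun setT b,
      forall k, (P [set w | b w = k] <= (12 / M%:R ^+ (K.+1).*2)%:E)%E,
      forall w, `|Y w - X w| <= 2 / M%:R &
      (forall w w', (b w = b w' /\ `|Y w - Y w'| = shrinking_ratio R K M * `|X w - X w'|) \/
        center_gap R K M <= `|Y w - Y w'|) /\
      (forall w, exists2 n, (M <= n)%N &
        forall t, `|t - Y w| <= shrinking_ratio R K M / (2 * M%:R) -> gd_union r n t)].
Proof.
move=> spl M0 rthick mX X01.
have MR : 0 < M%:R :> R by rewrite ltr0n.
have M1 : 1 <= M%:R :> R by rewrite ler1n.
set kappa := shrinking_ratio _ _ _; set sigma := center_gap _ _ _.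
set Q := M%:R ^+ _ in rthick.
have kE : kappa = sigma * expR (- Q) * M%:R by [].
have eQ0 : 0 < expR (- Q) by exact: expR_gt0.
have eQ1 : expR (- Q) <= 1 by rewrite -expR0 ler_expR oppr_le0 exprn_ge0// ltW.
have p0 n : 0 < M%:R ^+ n :> R by exact: exprn_gt0.
have p4 n : 0 < 4 * M%:R ^+ n :> R by exact: mulr_gt0.
have s0 : 0 < sigma by rewrite invr_gt0 mulr_gt0// p0.
have s4 : sigma <= 4^-1.
  by rewrite /sigma lef_pV2 ?posrE ?p4// ler_peMr// exprn_ege1.
have k0 : 0 < kappa by rewrite kE !mulr_gt0.
have kM : kappa / M%:R = sigma * expR (- Q) by rewrite kE mulfK// gt_eqF.
have kMs : kappa / M%:R <= sigma by rewrite kM ler_piMr// ltW.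
pose L := (M ^ K.+1)%N.
have LE : L%:R = M%:R ^+ K.+1 :> R by exact: natrX.
have L0 : (0 < L)%N by rewrite expn_gt0 M0.
pose s := reduced_centers L.
have sL : (L ^ 2 <= 12 * size s)%N := reduced_centers_ge L.
have size0 : (0 < size s)%N.
  by move: sL; case: (size s) => //; rewrite muln0 leqn0 expn_eq0 andbT => /eqP L00; rewrite L00 in L0.
have [b [mb bs Pb]] := spl _ size0.
pose mi k := nth (1, 0)%N s k.
have miP w : [/\ (0 < (mi (b w)).1 <= L)%N, ((mi (b w)).2 < (mi (b w)).1)%N &
    coprime (2 * (mi (b w)).2 + 1) (mi (b w)).1].
  by apply: (@mem_reduced_centers L); rewrite -surjective_pairing mem_nth.
pose a w := Num.truncn (M%:R * X w).
have aP w : (a w)%:R <= M%:R * X w < (a w).+1%:R.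
  by apply: truncn_itv; rewrite mulr_ge0//; case/andP: (X01 w).
have aM w : (a w < M)%N.
  rewrite -(ltr_nat R); have /andP[+ _] := aP w => /le_lt_trans; apply.
  by rewrite gtr_pMr//; case/andP: (X01 w).
have ma : measurable_fun setT a.
  by apply: measurable_truncn; apply: measurable_funM.
pose j x k := (x * (mi k).1 + (mi k).2)%N.
pose c x k : R := gd_center R (j x k) (M * (mi k).1).
pose Y w := c (a w) (b w) + kappa * (X w - ((a w)%:R + 2^-1) / M%:R).
have Yc w : `|Y w - c (a w) (b w)| <= kappa / (2 * M%:R).
  rewrite /Y addrC addKr normrM (gtr0_norm k0) ler_pM2l//.
  have -> : X w - ((a w)%:R + 2^-1) / M%:R = (M%:R * X w - (a w)%:R - 2^-1) / M%:R.
    by field; rewrite gt_eqF.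
  rewrite normrM normfV (gtr0_norm MR) invfM ler_pM2r ?invr_gt0//.
  have := aP w; rewrite -natr1 ler_norml => /andP[? ?]; apply/andP; split; lra.
have mY : measurable_fun setT Y.
  apply: (@measurable_fun_nat_param _ _ _ a
    (fun x w => c x (b w) + kappa * (X w - (x%:R + 2^-1) / M%:R))) => // x.
  apply: (@measurable_fun_nat_param _ _ _ b
    (fun k w => c x k + kappa * (X w - (x%:R + 2^-1) / M%:R))) => // k.
  apply: measurable_funD => //; apply: measurable_funM => //.
  exact: measurable_funB.
have half : kappa / (2 * M%:R) = kappa / M%:R / 2 by rewrite invfM mulrA mulrAC.
have Ms : M%:R * sigma <= 4^-1.
  rewrite /sigma /center_gap addn3 exprS mulrCA invfM mulrA mulfV ?gt_eqF// mul1r.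
  rewrite lef_pV2 ?posrE ?p4//.
  by rewrite -[leLHS]mulr1 ler_pM2l// exprn_ege1.
exists Y; exists b; split=> //.
- move=> k; apply: le_trans (Pb k) _; rewrite lee_fin.
  rewrite -[leLHS]mul1r ler_pdivrMr ?ltr0n// mulrAC ler_pdivlMr ?p0// mul1r.
  have : L%:R ^+ 2 <= 12 * (size s)%:R :> R by rewrite -natrX -natrM ler_nat.
  by rewrite LE -exprM muln2.
- move=> w; have [/andP[m0 mL] im _] := miP w.
  have cX : `|c (a w) (b w) - X w| <= M%:R^-1 by exact: gd_center_cell.
  have -> : Y w - X w = (Y w - c (a w) (b w)) + (c (a w) (b w) - X w) by ring.
  rewrite (le_trans (ler_normD _ _))//.
  have -> : 2 / M%:R = M%:R^-1 + M%:R^-1 :> R by ring.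
  apply: lerD => //; apply: le_trans (Yc w) _; rewrite half.
  have sM : sigma <= 4^-1 * M%:R^-1 by rewrite ler_pdivlMr// mulrC.
  have : 0 < M%:R^-1 :> R by rewrite invr_gt0.
  lra.
split=> w.
  move=> w'.
  have [/eqP[aa bb]|ne] := boolP ((a w, b w) == (a w', b w')).
    left; split => //; rewrite /Y aa bb.
    have -> : c (a w') (b w') + kappa * (X w - ((a w')%:R + 2^-1) / M%:R) -
      (c (a w') (b w') + kappa * (X w' - ((a w')%:R + 2^-1) / M%:R)) =
      kappa * (X w - X w') by ring.
    by rewrite normrM (gtr0_norm k0).
  right; have [mL im co] := miP w; have [mL' im' co'] := miP w'.
  have cc : (2 * M%:R * L%:R ^+ 2)^-1 <= `|c (a w) (b w) - c (a w') (b w')|.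
    apply: gd_center_dist => //; apply: contraNneq ne => E.
    have [/andP[m0 _] /andP[m0' _]] := (mL, mL').
    have [-> mm ii] := reduced_center_inj m0 m0' im im' co co' E.
    have mm' : mi (b w) = mi (b w').
      by rewrite (surjective_pairing (mi (b w))) mm ii -surjective_pairing.
    have := nth_uniq (1, 0)%N (bs w) (bs w') (uniq_reduced_centers L).
    by rewrite -/s -/(mi _) -/(mi _) mm' eqxx => /esym/eqP ->.
  have E2 : (2 * M%:R * L%:R ^+ 2)^-1 = sigma *+ 2.
    have -> : sigma = (4 * M%:R ^+ (K.+1 * 2).+1)^-1.
      by rewrite /sigma /center_gap; congr ((4 * _ ^+ _)^-1); clear; lia.
    rewrite LE -exprM exprS; field.
    by rewrite gt_eqF// gt_eqF// p0.
  rewrite E2 in cc.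
  have := Yc w; have := Yc w'; rewrite half => y1 y2.
  have tri : `|c (a w) (b w) - c (a w') (b w')| <=
      `|Y w - Y w'| + (`|Y w - c (a w) (b w)| + `|Y w' - c (a w') (b w')|).
    have -> : c (a w) (b w) - c (a w') (b w') =
     (Y w - Y w') - ((Y w - c (a w) (b w)) - (Y w' - c (a w') (b w'))) by ring.
    by rewrite (le_trans (ler_normB _ _))// lerD2l ler_normB.
  lra.
have [/andP[m0 mL] im _] := miP w.
exists (M * (mi (b w)).1)%N; first by rewrite leq_pmulr.
move=> t tY; exists (j (a w) (b w)).
  rewrite /= /j; have := aM w.
  by move: m0 im; clear; case: (mi (b w)) => m i /=; nia.
have rn : expR (- Q) <= r (M * (mi (b w)).1)%N.
  apply: rthick; rewrite leq_pmulr//= expnS leq_mul2l mL orbT//.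
have tc : `|t - c (a w) (b w)| <= kappa / M%:R.
  have -> : t - c (a w) (b w) = (t - Y w) + (Y w - c (a w) (b w)) by ring.
  rewrite (le_trans (ler_normD _ _))// (splitr (kappa / M%:R)) -half lerD//.
have kr : kappa / M%:R < r (M * (mi (b w)).1)%N / 2.
  rewrite kM; have : sigma * expR (- Q) <= 4^-1 * expR (- Q) by rewrite ler_wpM2r// ltW.
  lra.
rewrite /gd_interval /= in_itv /=; move: tc; rewrite ler_norml /c => /andP[? ?].
by apply/andP; split; lra.
Qed.

End redistribution_map.

(** * One redistribution step *)

Section redistribution_step.
Context {R : realType} {d} {T : measurableType d} (P : probability T R).

Lemma oppr_ln1B (x : R) : 0 <= x <= 2^-1 -> - ln (1 - x) <= x *+ 2.
Proof.
move=> /andP[x0 x2].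
have y0 : 0 < 1 - x by lra.
rewrite -lnV ?posrE//.
have -> : (1 - x)^-1 = 1 + x / (1 - x) by field; rewrite gt_eqF.
apply: le_trans (le_ln1Dx _) _.
  by rewrite (lt_le_trans (ltrN10 _))// divr_ge0// ltW.
rewrite ler_pdivrMr//; nra.
Qed.

Lemma center_gap01 K M : (0 < M)%N -> 0 < center_gap R K M <= 1.
Proof.
move=> M0; have p0 n : 1 <= M%:R ^+ n :> R by rewrite exprn_ege1// ler1n.
rewrite /center_gap; set x := M%:R ^+ _; have x1 : 1 <= x by exact: p0.
by rewrite invr_gt0 invf_le1; lra.
Qed.

(** The gap is a power of [1 / M] up to a factor, as is [8 / M]: their logarithms
    are comparable, which is what [close_pairs_small] needs. *)
Lemma ln_center_gap K M : (64 <= M)%N ->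
  - ln (center_gap R K M) <= (K.*2.*2 + 8)%:R * - ln ((4 / M%:R) *+ 2 : R).
Proof.
move=> M64.
have M0 : 0 < M%:R :> R by rewrite ltr0n; lia.
have l2 : 0 < ln (2 : R) by rewrite ln_gt0// ltr1n.
have lM : ln (2 : R) *+ 6 <= ln M%:R.
  by rewrite -lnXn// ler_ln ?posrE ?exprn_gt0// -natrX ler_nat.
have l4 : ln (4 : R) = ln 2 *+ 2.
  by rewrite -lnXn//; congr ln; rewrite expr2 -natrM.
have -> : (4 / M%:R) *+ 2 = 2 ^+ 3 / M%:R :> R.
  by rewrite !exprS expr0; field; rewrite gt_eqF.
rewrite /center_gap -lnV ?posrE ?invr_gt0 ?mulr_gt0 ?exprn_gt0// invrK.
rewrite lnM ?posrE ?exprn_gt0// lnXn// l4 lnM ?posrE ?exprn_gt0 ?invr_gt0// lnXn//.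
rewrite lnV ?posrE// -[ln M%:R *+ _]mulr_natl.
have -> : (K.*2.*2 + 8)%:R = 2 * ((K.*2 + 3)%:R + 1) :> R.
  by rewrite natr1 -natrM; congr (_%:R); lia.
move: (K.*2 + 3)%N => k; have k0 : 0 <= k%:R :> R by [].
have : 0 <= (k%:R + 1) * (ln M%:R - ln (2 : R) *+ 6) by apply: mulr_ge0; rewrite ?subr_ge0// addr_ge0.
nra.
Qed.

Lemma shrinking_ratio01 K M : (0 < M)%N -> 0 < shrinking_ratio R K M <= 1.
Proof.
move=> M0; have MR : 0 < M%:R :> R by rewrite ltr0n.
have /andP[s0 s1] := center_gap01 K M0.
rewrite /shrinking_ratio !mulr_gt0 ?expR_gt0//= mulrAC.
have e1 : expR (- (M%:R ^+ (K.*2.+1))) <= 1 :> R.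
  by rewrite -expR0 ler_expR oppr_le0 exprn_ge0// ltW.
have sM : center_gap R K M * M%:R <= 1.
  rewrite /center_gap mulrC ler_pdivrMr ?mulr_gt0 ?exprn_gt0// mul1r addn3 exprS.
  rewrite mulrCA ler_peMr ?(ltW MR)//.
  have : 1 <= M%:R ^+ K.*2.+2 :> R by rewrite exprn_ege1// ler1n.
  by set x := _ ^+ _; lra.
by rewrite -[leRHS]mulr1; apply: ler_pM => //; rewrite ?mulr_ge0 ?expR_ge0 ?ltW.
Qed.

(** The loss of the pairs sharing a centre, weighted by their probability: the main
    term of the logarithm is [M ^ (2 K + 1)] and the rest is logarithmic in [M]. *)
Lemma ln_shrinking_ratio K M : (0 < M)%N ->
  - ln (shrinking_ratio R K M) * (12 / M%:R ^+ (K.+1).*2) <= 60 / M%:R.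
Proof.
move=> M0; have MR : 0 < M%:R :> R by rewrite ltr0n.
have M1 : 1 <= M%:R :> R by rewrite ler1n.
pose N : R := M%:R ^+ K.+1.
have N0 : 0 < N by rewrite exprn_gt0.
have N1 : 1 <= N by rewrite exprn_ege1.
have MN : M%:R <= N by rewrite /N exprS ler_peMr ?exprn_ege1// ltW.
have N2 : M%:R ^+ (K.+1).*2 = N ^+ 2 by rewrite /N -exprM muln2.
have QE : M%:R ^+ K.*2.+1 = N ^+ 2 / M%:R.
  by rewrite -N2 doubleS [in RHS]exprS mulrAC mulfV ?mul1r// gt_eqF.
have E : shrinking_ratio R K M = expR (- (N ^+ 2 / M%:R)) / (2 * N) ^+ 2.
  rewrite /shrinking_ratio /center_gap QE mulrAC mulrC; congr (_ * _).
  have -> : (K.*2 + 3 = (K.+1).*2.+1)%N by lia.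
  by rewrite exprS N2; field; rewrite !gt_eqF.
have lN : ln (2 * N) <= 2 * N by apply/ltW/ln_sublinear; rewrite mulr_gt0.
rewrite E lnM ?posrE ?expR_gt0 ?invr_gt0 ?exprn_gt0 ?mulr_gt0// expRK.
rewrite lnV ?posrE ?exprn_gt0 ?mulr_gt0// lnXn ?mulr_gt0// N2.
have -> : 60 / M%:R = (60 * (N ^+ 2 / M%:R)) / N ^+ 2 :> R.
  by field; rewrite !gt_eqF.
rewrite [leLHS]mulrA; apply: ler_wpM2r; first by rewrite invr_ge0 exprn_ge0 ?ltW.
have : N <= N ^+ 2 / M%:R by rewrite ler_pdivlMr// expr2 ler_wpM2l// ltW.
move: (N ^+ 2 / M%:R) (ln (2 * N)) lN => A l lN NA; lra.
Qed.

(** The margin [s] is a budget for the present and future moves: a half of it is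
    spent here.  The next budget [s'] is at most the other half, and so small that
    no later move leaves [gd_union r n]. *)
Lemma redistribution_step (r : nat -> R) (K n0 : nat) (X : T -> R) (s e : R) :
  thick_radii r K -> splittable P -> measurable_fun setT X ->
  0 < s -> (forall w, s <= X w <= 1 - s) -> (lenergy P X < +oo)%E -> 0 < e ->
  exists Y : T -> R, exists s' : R,
    [/\ measurable_fun setT Y, 0 < s' <= s / 2, forall w, `|Y w - X w| <= s / 2,
      (lenergy P Y <= lenergy P X + e%:E)%E &
      forall w, exists2 n, (n0 <= n)%N & forall t, `|t - Y w| <= s' -> gd_union r n t].
Proof.
move=> hr spl mX s0 Xs fin e0.
have X01 w : 0 <= X w <= 1.
  by have /andP[? ?] := Xs w; apply/andP; split; lra.
pose C0 : R := (K.*2.*2 + 8)%:R.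
have C08 : 8 <= C0 by rewrite ler_nat leq_addl.
(* The denominator [C0] anticipates the factor of [ln_center_gap]. *)
pose e' := e / 4 / C0.
have C00 : 0 < C0 by exact: lt_le_trans C08.
have e'0 : 0 < e' by rewrite !divr_gt0.
have [D /andP[D0 D1] small] := close_pairs_small mX X01 fin e'0.
pose eta := D / 2.
have eta0 : 0 < eta by rewrite divr_gt0.
(* Each summand is one of the constraints on [M] used below. *)
pose bnd := 64 + 8 / D + 8 / eta + 32 / e / eta + 240 / e + 4 / s.
have [M [Mb [Mn0 Mr]]] : exists M, bnd <= M%:R /\ ((n0 <= M)%N /\
   forall n, (M <= n <= M ^ K.+2)%N -> expR (- (M%:R ^+ (K.*2.+1))) <= r n).
  apply: (@filter_ex _ \oo); near=> M; split; [|split].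
  - by near: M; exact: nbhs_infty_ger.
  - by near: M; exact: nbhs_infty_ge.
  - by near: M; exact: hr.
have [b1 b2 b3 b4 [b5 b6]] : [/\ 64 <= M%:R :> R, 8 / D <= M%:R, 8 / eta <= M%:R,
    32 / e / eta <= M%:R & 240 / e <= M%:R /\ 4 / s <= M%:R].
  have t1 : 0 < 8 / D by rewrite divr_gt0.
  have t2 : 0 < 8 / eta by rewrite divr_gt0.
  have t3 : 0 < 32 / e / eta by rewrite !divr_gt0.
  have t4 : 0 < 240 / e by rewrite divr_gt0.
  have t5 : 0 < 4 / s by rewrite divr_gt0.
  by move: Mb; rewrite /bnd => Mb; split; lra.
have MR : 0 < M%:R :> R by lra.
have M0 : (0 < M)%N by rewrite -(ltr0n R).
have swap (x y : R) : 0 < y -> x / y <= M%:R -> x / M%:R <= y.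
  by move=> y0; rewrite ler_pdivrMr// ler_pdivrMr// mulrC.
have X01' w : 0 <= X w < 1.
  by have /andP[? ?] := Xs w; apply/andP; split; lra.
have [Y [b [mY mb Pb YX [sep ball]]]] := redistribution_map spl M0 Mr mX X01'.
have k01 := shrinking_ratio01 K M0.
have g01 := center_gap01 K M0.
have Ys w : `|Y w - X w| <= s / 2.
  apply: le_trans (YX w) _; rewrite ler_pdivrMr// mulrC mulrA.
  by move: b6; rewrite ler_pdivrMr//; lra.
have Y01 w : 0 <= Y w <= 1.
  have /andP[? ?] := Xs w; have := Ys w; rewrite ler_norml => /andP[? ?].
  by apply/andP; split; lra.
pose rho := shrinking_ratio R K M / (2 * M%:R).
have rho0 : 0 < rho by have /andP[k0 _] := k01; apply: divr_gt0 => //; exact: mulr_gt0.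
exists Y, (Num.min (s / 2) rho); split => //.
- by rewrite lt_min rho0 andbT divr_gt0//= ge_min lexx.
- pose u : R := 4 / M%:R.
  have u0 : 0 < u by rewrite divr_gt0.
  have ueta : u <= eta / 2.
    have := swap _ _ eta0 b3; rewrite /u; lra.
  have uD : u *+ 2 <= D by have := swap _ _ D0 b2; rewrite /u; lra.
  have e1 : - ln (1 - u / eta) <= e / 4.
    apply: le_trans (oppr_ln1B _) _.
      by rewrite ltW ?divr_gt0//= ler_pdivrMr// mulrC.
    have := swap _ _ eta0 b4; rewrite mulrAC ler_pdivrMr// => h.
    suff : u / eta <= e / 8 by lra.
    by rewrite ler_pdivrMr// /u; lra.
  have YX' w : `|Y w - X w| <= u / 2 by apply: le_trans (YX w) _; rewrite /u; lra.
  apply: le_trans (lenergy_redistribution mX mY mb X01 Y01 u0 eta0 ueta e1 g01 k01 YX' sep Pb) _.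
  rewrite leeD2l//.
  have t1 : (((ln 2)%:E * (P \x P)%E (close_pairs X eta)) <= (e / 4)%:E)%E.
    apply: (@le_trans _ _ ((- ln eta)%:E * (P \x P)%E (close_pairs X eta))%E).
      rewrite lee_wpmul2r// lee_fin -lnV ?posrE// ler_ln ?posrE ?invr_gt0//.
      by rewrite -[leLHS]invrK lef_pV2 ?posrE ?invr_gt0// /eta; lra.
    apply: le_trans (small eta _) _; first by apply/andP; split => //; rewrite /eta; lra.
    have e4 : 0 < e / 4 by exact: divr_gt0.
    by rewrite lee_fin /e' ler_pdivrMr// ler_peMr ?(ltW e4)//; lra.
  have t2 : (((- ln (center_gap R K M))%R%:E * (P \x P)%E (close_pairs X (u *+ 2)%R)) <= (e / 4)%:E)%E.
    have M64 : (64 <= M)%N by rewrite -(ler_nat R).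
    apply: (@le_trans _ _ (C0%:E * ((- ln (u *+ 2))%R%:E * (P \x P)%E (close_pairs X (u *+ 2)%R)))%E).
      rewrite muleA -EFinM lee_wpmul2r// lee_fin; exact: ln_center_gap.
    have := small (u *+ 2); rewrite uD pmulrn_lgt0// u0 => /(_ isT) h.
    have := lee_wpmul2l _ h => /(_ C0%:E); rewrite lee_fin => /(_ (ltW C00)) h'.
    apply: le_trans h' _; rewrite -EFinM lee_fin /e' mulrC divfK// gt_eqF//.
  have t3 : ((- ln (shrinking_ratio R K M) * (12 / M%:R ^+ (K.+1).*2))%:E <= (e / 4)%:E)%E.
    rewrite lee_fin; apply: le_trans (ln_shrinking_ratio K M0) _.
    by have := swap _ _ e0 b5; lra.
  apply: (@le_trans _ _ ((e / 4)%:E + ((e / 4)%:E + ((e / 4)%:E + (e / 4)%:E)))%E).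
    by rewrite leeD2l// leeD// leeD.
  by rewrite -!EFinD lee_fin; lra.
- move=> w; have [n Mn bn] := ball w; exists n; first exact: leq_trans Mn.
  by move=> t tY; apply: bn; apply: le_trans tY _; rewrite ge_min lexx orbT.
Unshelve. all: by end_near. Qed.

End redistribution_step.

(** * Iteration and passage to the limit *)

Section redistribution_limit.
Context {R : realType} {d} {T : measurableType d} (P : probability T R).

Lemma cvg_logk (u : nat -> R) (t : R) : u @ \oo --> t -> logk (u n) @[n --> \oo] --> logk t.
Proof.
move=> ut; have nut : `|u n| @[n --> \oo] --> `|t| by exact: cvg_norm.
have [t0|t0] := eqVneq t 0.
  rewrite t0 logk0; apply/cvgeyPge => A.
  move: nut; rewrite t0 normr0 => /cvgrPdist_le /(_ _ (expR_gt0 (- A))).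
  apply: filterS => n; rewrite sub0r normrN normr_id => h.
  have -> : A%:E = logk (expR (- A)).
    by rewrite logkE ?gt_eqF ?expR_gt0// gtr0_norm ?expR_gt0// expRK opprK.
  by apply: le_logk; rewrite (gtr0_norm (expR_gt0 _)).
have nt0 : 0 < `|t| by rewrite normr_gt0.
rewrite logkE//.
have lnu : (- ln `|u n|)%:E @[n --> \oo] --> (- ln `|t|)%:E.
  apply: cvg_EFin; first by apply: nearW.
  apply: cvgN; apply: (cvg_comp _ _ nut); exact: continuous_ln.
apply: cvg_trans lnu; apply: near_eq_cvg.
near=> n; rewrite logkE// -normr_gt0.
by near: n; apply: (cvgr_gt _ nut).
Unshelve. all: by end_near. Qed.

(** The intervals of centre [X k w] and radius [s k] decrease to the point [G w],
    and the one of index [k.+1] is included in some [gd_union r n] with [k <= n];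
    so [G w] belongs to infinitely many of these unions. *)
Lemma redistribution_limit (r : nat -> R) (K : nat) (X0 : T -> R) (s0 e : R) :
  thick_radii r K -> splittable P -> measurable_fun setT X0 ->
  0 < s0 -> (forall w, s0 <= X0 w <= 1 - s0) -> (lenergy P X0 < +oo)%E -> 0 < e ->
  exists G : T -> R, [/\ measurable_fun setT G, forall w, `|G w - X0 w| <= s0,
    forall w, uniform_Gdelta r (G w) & (lenergy P G <= lenergy P X0 + e%:E)%E].
Proof.
move=> hr spl mX0 s00 Xs0 fin0 e0.
pose inv (p : nat * (T -> R) * R) := [/\ measurable_fun setT p.1.2, 0 < p.2,
  forall w, p.2 <= p.1.2 w <= 1 - p.2 & (lenergy P p.1.2 < +oo)%E].
pose rel (p q : {p | inv p}) := let: (n, X, s) := sval p in let: (n', Y, s') := sval q in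
  [/\ n' = n.+1, s' <= s / 2, forall w, `|Y w - X w| <= s / 2,
    (lenergy P Y <= lenergy P X + (e / 2 ^+ n.+1)%:E)%E &
    forall w, exists2 m, (n <= m)%N & forall t, `|t - Y w| <= s' -> gd_union r m t].
have step p : {q | rel p q}.
  apply/cid; case: p => [[[n X] s]] [/= mX sp Xs fin].
  have en : 0 < e / 2 ^+ n.+1 by rewrite divr_gt0// exprn_gt0.
  have [Y [s' [mY /andP[s'0 s's] YX YE ball]]] :=
    redistribution_step n hr spl mX sp Xs fin en.
  have iY : inv (n.+1, Y, s').
    split=> //=; last by rewrite (le_lt_trans YE)// lte_add_pinfty// ltry.
    move=> w; have := Xs w; have := YX w; rewrite ler_norml.
    by move=> /andP[? ?] /andP[? ?]; apply/andP; split; lra.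
  by exists (exist _ _ iY).
have inv0 : inv (0%N, X0, s0) by [].
have [f [f0 frel]] := dependent_choice step (exist _ _ inv0).
pose X k := (sval (f k)).1.2; pose s k := (sval (f k)).2.
have fn k : (sval (f k)).1.1 = k.
  elim: k => [|k IH]; first by rewrite f0.
  by have := frel k; rewrite /rel; move: IH; case: (sval (f k)) => [[n ?] ?] /= ->;
    case: (sval (f k.+1)) => [[? ?] ?] /= [-> _ _ _ _].
have fstep k : [/\ s k.+1 <= s k / 2, forall w, `|X k.+1 w - X k w| <= s k / 2,
    (lenergy P (X k.+1) <= lenergy P (X k) + (e / 2 ^+ k.+1)%:E)%E &
    forall w, exists2 m, (k <= m)%N & forall t, `|t - X k.+1 w| <= s k.+1 -> gd_union r m t].
  have := frel k; rewrite /rel /X /s; have := fn k.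
  by case: (sval (f k)) => [[n ?] ?] /= ->; case: (sval (f k.+1)) => [[? ?] ?] /= [_ ? ? ? ?].
have finv k : inv (sval (f k)) by exact: svalP.
have mX k : measurable_fun setT (X k) by have [] := finv k.
have sp k : 0 < s k by have [] := finv k.
have XsE : X 0%N = X0 /\ s 0%N = s0 by rewrite /X /s f0.
have X01 k w : 0 <= X k w <= 1.
  have [_ ? /(_ w) /andP[h1 h2] _] := finv k; rewrite -/(X k) -/(s k) in h1 h2.
  by have ? := sp k; apply/andP; split; lra.
have nested k l w : `|X (k + l)%N w - X k w| <= s k - s (k + l)%N.
  elim: l => [|l IH]; first by rewrite addn0 !subrr normr0.
  rewrite addnS; have [h1 /(_ w) h2 _ _] := fstep (k + l)%N.
  have -> : X (k + l).+1 w - X k w =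
    (X (k + l).+1 w - X (k + l)%N w) + (X (k + l)%N w - X k w) by ring.
  apply: le_trans (ler_normD _ _) _; lra.
have s_small k : s k <= s0 / 2 ^+ k.
  elim: k => [|k IH]; first by rewrite expr0 divr1; case: XsE => _ ->.
  have [h1 _ _ _] := fstep k; apply: le_trans h1 _.
  by rewrite exprSr invfM mulrA ler_wpM2r.
have s_cvg : s @ \oo --> (0 : R).
  apply: (@squeeze_cvgr _ _ _ _ (cst 0) (fun k => s0 / 2 ^+ k)).
  - by apply: nearW => k; rewrite /cst (ltW (sp k)) s_small.
  - exact: cvg_cst.
  - rewrite -[X in _ --> X](mulr0 s0); apply: cvgMr.
    under eq_fun do rewrite -exprVn.
    by apply: cvg_expr; rewrite gtr0_norm// invf_lt1// ltr1n.
(* The lower ends of the nested intervals increase to the limit point. *)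
pose lo w k := X k w - s k.
have lo_nd w : nondecreasing_seq (lo w).
  apply/nondecreasing_seqP => k; rewrite /lo.
  have := nested k 1%N w; rewrite addn1 ler_norml => /andP[? ?]; lra.
have lo_ub w k l : lo w k <= X l w + s l.
  have [kl|lk] := leqP k l.
    apply: le_trans (lo_nd w _ _ kl) _; rewrite /lo; have := sp l; lra.
  have := nested l (k - l)%N w; rewrite subnKC ?(ltnW lk)// ler_norml => /andP[? ?].
  by rewrite /lo; have := sp k; lra.
pose G w := limn (lo w).
have lo_cvg w : lo w @ \oo --> G w.
  apply: (nondecreasing_is_cvgn (lo_nd w)).
  by exists (X 0%N w + s 0%N) => _ [k _ <-]; exact: lo_ub.
have GX k w : `|G w - X k w| <= s k.
  have h1 : lo w k <= G w.
    by apply: nondecreasing_cvgn_le => //; apply/cvg_ex; exists (G w).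
  have h2 : G w <= X k w + s k.
    by apply: limr_le; [apply/cvg_ex; exists (G w)|apply: nearW => l; exact: lo_ub].
  rewrite ler_norml; move: h1; rewrite /lo => h1; apply/andP; split; lra.
have X_cvg w : X k w @[k --> \oo] --> G w.
  have -> : (fun k => X k w) = (fun k => lo w k + s k).
    by apply/funext => k; rewrite /lo subrK.
  by rewrite -[X in _ --> X]addr0; exact: cvgD.
have mG : measurable_fun setT G.
  by apply: (measurable_fun_cvg (h := X)) => // w _; exact: X_cvg.
have G01 w : 0 <= G w <= 1.
  have /andP[? ?] := Xs0 w; have := GX 0%N w; case: XsE => -> ->.
  by rewrite ler_norml => /andP[? ?]; apply/andP; split; lra.
exists G; split => //.
- by case: XsE => <- <- w; exact: GX.
- move=> w m /= m1.
  have [_ _ _ /(_ w) [n mn ball]] := fstep m.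
  by exists n => //; apply: ball; exact: GX.
have Xe k : (lenergy P (X k) <= lenergy P X0 + (e * (1 - 2^-1 ^+ k))%R%:E)%E.
  elim: k => [|k IH]; first by rewrite expr0 subrr mulr0 adde0; case: XsE => ->.
  have [_ _ h _] := fstep k; apply: le_trans h _.
  apply: (le_trans (leeD2r _ IH)); rewrite -addeA -EFinD leeD2l// lee_fin.
  by rewrite -exprVn !exprS; lra.
have Xe' k : (lenergy P (X k) <= lenergy P X0 + e%:E)%E.
  apply: le_trans (Xe k) _; rewrite leeD2l// lee_fin.
  have : 0 <= (2^-1 : R) ^+ k by rewrite exprn_ge0// invr_ge0.
  by move: (_ ^+ k) => x x0; nra.
have -> : lenergy P G = (\int[P \x P]_p limn_einf (fun k => logk (pdist (X k) p)))%E.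
  apply: eq_integral => p _; apply/esym.
  have c : logk (pdist (X k) p) @[k --> \oo] --> logk (pdist G p).
    by apply: cvg_logk; apply: cvgB; exact: X_cvg.
  by have [] := cvg_limn_einf_sup c.
apply: le_trans.
  apply: (@fatou _ _ _ (P \x P)%E setT measurableT (fun k p => logk (pdist (X k) p))).
  - by move=> k; exact: measurable_logk_pdist.
  - by move=> k p _; apply/logk_ge0/pdist_le1/X01.
rewrite limn_einf_lim; apply: lime_le; first exact: is_cvg_einfs.
apply: nearW => k; apply: le_trans (Xe' k).
by apply: ereal_inf_lbound; exists k => //=.
Qed.

End redistribution_limit.

(** * Size of the radii *)

Section radii.
Context {R : realType}.

(** Eventually [r n >= exp (- n)], and [n <= M ^ 3] in the range considered. *)
Lemma thick_subexponential (r : nat -> R) : subexponential_radii r -> thick_radii r 1.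
Proof.
move=> [_ r0 _ _ /eqoP /(_ 1 ltr01) rn].
have [N _ HN] := rn.
exists N.+1 => // M /= NM n /andP[Mn nM].
have n1 : (1 <= n)%N by apply: leq_trans Mn; apply: leq_trans NM.
have := HN n (leq_trans (ltnW NM) Mn); rewrite /= mul1r normr_id normr_nat => h.
rewrite -[leRHS]lnK ?posrE ?r0// ler_expR.
have nMr : n%:R <= M%:R ^+ 3 :> R by rewrite -natrX ler_nat.
by move: h; rewrite ler_norml => /andP[h _]; lra.
Qed.

(** For [n <= M ^ K.+2] the exponent [n ^ alpha] is at most
    [M ^ (K.+2 * alpha)], so it suffices that [K.+2 * alpha <= 2 K + 1], which holds
    for [K] large since [alpha < 2]. *)
Lemma thick_stretched_exponential (r : nat -> R) : stretched_exponential_radii r ->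
  exists K, thick_radii r K.
Proof.
move=> [alpha /andP[a0 a2] rE].
pose K := Num.truncn ((alpha + 1) / (2 - alpha)).
have aK : (K.+2)%:R * alpha <= (K.*2.+1)%:R.
  have : (alpha + 1) / (2 - alpha) < K.+1%:R by exact: truncnS_gt.
  rewrite ltr_pdivrMr; last lra.
  have -> : K.+2%:R = K.+1%:R + 1 :> R by rewrite natr1.
  have -> : (K.*2.+1)%:R = 2 * K.+1%:R - 1 :> R.
    have -> : (K.*2.+1 = 2 * K.+1 - 1)%N by lia.
    by rewrite natrB ?muln_gt0// natrM.
  by move: (K.+1%:R) => k; nra.
exists K, 1%N => // M /= M1 n /andP[Mn nM].
have n1 : (1 <= n)%N by exact: leq_trans Mn.
rewrite rE// ler_expR lerN2.
have M1r : 1 <= M%:R :> R by rewrite ler1n.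
apply: (@le_trans _ _ ((M ^ K.+2)%:R `^ alpha)).
  by rewrite ge0_ler_powR ?(ltW a0) ?nnegrE ?ler_nat.
rewrite natrX -powR_mulrn// -powRrM -powR_mulrn//.
by rewrite ler_powR.
Qed.

Lemma exists_thick_radii (r : nat -> R) :
  subexponential_radii r \/ stretched_exponential_radii r -> exists K, thick_radii r K.
Proof.
move=> [/thick_subexponential h|/thick_stretched_exponential//].
by exists 1%N.
Qed.

End radii.

(** * Borel sets and measurable functions of the complex plane *)

Section borel_complex.
Context {R : realType}.

Lemma lt_norm_Re (z : R[i]) (e : R) : `|z| < real_complex R e -> `|complex.Re z| < e.
Proof. by move=> ze; rewrite -ltcR; apply: le_lt_trans ze; exact: normc_ge_Re. Qed.

Lemma lt_norm_Im (z : R[i]) (e : R) : `|z| < real_complex R e -> `|complex.Im z| < e.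
Proof.
move=> ze; rewrite -normrN -ReiNIm; apply: lt_norm_Re.
have n1 : `|'i%C : R[i]| = 1.
  by rewrite normc_def /= expr0n expr1n add0r sqrtr1.
by rewrite normrM n1 mulr1.
Qed.

(** A real function which is non-expanding for the modulus is continuous, hence
    Borel. *)
Lemma measurable_coordinate (f : borelC R -> R) :
  (forall (z w : R[i]) (e : R), `|z - w| < real_complex R e -> `|f z - f w| < e) ->
  measurable_fun setT f.
Proof.
move=> fe; apply: (measurability _ (RGenOInfty.measurableE R)).
move=> _ [_ [a ->] <-]; rewrite setTI.
apply: sub_sigma_algebra; rewrite /= openE => z /=; rewrite in_itv /= andbT => az.
apply/nbhs_ballP; exists (real_complex R (f z - a)).
  by rewrite /= (_ : 0 = real_complex R 0)// ltcR subr_gt0.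
move=> w /= zw; rewrite in_itv /= andbT.
by have := fe _ _ _ zw; rewrite ltr_norml => /andP[_]; lra.
Qed.

Lemma measurable_Re : measurable_fun setT (@complex.Re R : borelC R -> R).
Proof. by apply: measurable_coordinate => z w e /lt_norm_Re; rewrite raddfB. Qed.

Lemma measurable_Im : measurable_fun setT (@complex.Im R : borelC R -> R).
Proof. by apply: measurable_coordinate => z w e /lt_norm_Im; rewrite raddfB. Qed.

Lemma measurable_real_complex : measurable_fun setT (real_complex R : R -> borelC R).
Proof.
have := @measurability _ _ R (borelC R) setT (real_complex R : R -> borelC R) (@open (R[i])^o) erefl.
  apply.
move=> _ [A oA <-]; rewrite setTI; apply: open_measurable.
rewrite openE => x /= Ax; move: oA; rewrite openE => /(_ _ Ax) /nbhs_ballP[e e0 eA].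
apply/nbhs_ballP; have eR : real_complex R (complex.Re e) = e.
  by apply: RRe_real; rewrite ger0_real// ltW.
exists (complex.Re e); first by rewrite /= -ltcR eR.
move=> y xy; apply: eA; rewrite /ball /= -rmorphB /=.
by rewrite -eR normc_def /= expr0n addr0 sqrtr_sqr ltcR.
Qed.

Lemma measurable_image_real (A : set R) : measurable A ->
  measurable (real_complex R @` A : set (borelC R)).
Proof.
move=> mA; rewrite (_ : _ @` _ = (setT `&` @complex.Re R @^-1` A) `&`
   (setT `&` @complex.Im R @^-1` [set 0])).
  apply: measurableI; first exact: measurable_Re.
  by apply: measurable_Im => //; exact: measurable_set1.
apply/seteqP; split => [_ [x Ax <-]//|[x y] [[_ /= Ax] [_ /= ->]]].
by exists x.
Qed.

(** Joint measurability for the product of the two Borel sigma-algebras, read off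
    from the coordinates. *)
Lemma measurable_log_kernel : measurable_fun setT
  (fun p : borelC R * borelC R => log_kernel p.1 p.2).
Proof.
rewrite (_ : (fun p => _) = logk \o (fun p : borelC R * borelC R =>
  Num.sqrt ((complex.Re p.1 - complex.Re p.2) ^+ 2 + (complex.Im p.1 - complex.Im p.2) ^+ 2))); last first.
  apply/funext => -[[x y] [x' y']]; rewrite /log_kernel /logk normc_def /=.
  by rewrite ger0_norm// sqrtr_ge0.
have mfst (f : borelC R -> R) : measurable_fun setT f ->
    measurable_fun setT (fun p : borelC R * borelC R => (f p.1 - f p.2) ^+ 2).
  move=> mf; apply: measurable_funX; apply: measurable_funB.
    by apply: measurableT_comp => //; exact: measurable_fst.
  by apply: measurableT_comp => //; exact: measurable_snd.
apply: measurableT_comp; first exact: measurable_logk.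
apply: (@measurableT_comp _ _ _ _ _ _ (@Num.sqrt R)).
  by apply: continuous_measurable_fun; exact: sqrt_continuous.
by apply: measurable_funD; apply: mfst; [exact: measurable_Re|exact: measurable_Im].
Qed.

End borel_complex.

(** * Adjoining a uniform variable *)

Section uniform_randomization.
Context {R : realType} {d} {T : measurableType d} (mu : probability T R).
Local Open Scope ereal_scope.

(** An independent uniform variable on [0, 1] makes the space splittable: the label
    is the integer part of [N] times this variable. *)
Definition with_uniform := (mu \x uniform_prob (@ltr01 R)).

HB.instance Definition _ := Measure.on with_uniform.

Let with_uniform_setT : with_uniform setT = 1.
Proof.
rewrite /with_uniform -setXTT product_measure1E//.
by rewrite -[RHS]mule1; congr (_ * _); exact: probability_setT.
Qed.

HB.instance Definition _ :=
  Measure_isProbability.Build _ _ _ with_uniform with_uniform_setT.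

Lemma splittable_with_uniform : splittable with_uniform.
Proof.
move=> N N0; have NR : (0 < N%:R :> R)%R by rewrite ltr0n.
(* The cap at [N.-1] takes care of [u = 1]. *)
pose b (u : R) := minn (Num.truncn (N%:R * u)) N.-1.
have mb : measurable_fun setT b.
  have mt : measurable_fun setT (fun u : R => Num.truncn (N%:R * u)%R).
    by apply: measurable_truncn; exact: measurable_funM.
  apply: measurable_nat_fibers => k; rewrite -[X in measurable X]setTI.
  exact: (mt measurableT [set t | minn t N.-1 = k]).
have mbk k : measurable [set u | b u = k].
  by rewrite -[X in measurable X]setTI; exact: (mb measurableT [set k]).
exists (b \o snd); split.
- by apply: measurableT_comp => //; exact: measurable_snd.
- by move=> w; rewrite /= /b; lia.
move=> k; rewrite (_ : [set w | _] = setT `*` [set u | b u = k]); last first.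
  by apply/seteqP; split => w /=; [split|case].
rewrite /= /with_uniform product_measure1E//; last exact: mbk.
apply: (@le_trans _ _ (1 * uniform_prob (@ltr01 R) [set u | b u = k])).
  by apply: lee_wpmul2r => //; exact: probability_le1.
rewrite mul1e /uniform_prob integral_uniform_pdf.
have mI : measurable (`[(k%:R / N%:R)%R, (k.+1%:R / N%:R)%R] : set R) by [].
apply: (@le_trans _ _ (\int[@lebesgue_measure R]_(x in `[(k%:R / N%:R)%R, (k.+1%:R / N%:R)%R]) (cst 1 x))).
  apply: (@le_trans _ _ (\int[@lebesgue_measure R]_(x in [set u | b u = k] `&` `[0%R, 1%R]) (cst 1 x))).
    have mbI : measurable ([set u | b u = k] `&` `[0%R, 1%R]%classic) by exact: measurableI (mbk k) _.
    apply: ge0_le_integral => //=.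
    - by move=> x _; rewrite lee_fin uniform_pdf_ge0.
    - by apply/measurable_EFinP; apply: measurable_funTS; exact: measurable_uniform_pdf.
    - move=> x [_ x01]; rewrite lee_fin /uniform_pdf; move: x01; rewrite in_itv /= => ->.
      by rewrite subr0 invr1.
  apply: ge0_subset_integral => //=; first exact: measurableI (mbk k) _.
  move=> u [/= bu]; rewrite !in_itv /= => /andP[u0 u1].
  have := truncn_itv (mulr_ge0 (ltW NR) u0); set t := Num.truncn _ => /andP[t0 t1].
  rewrite ler_pdivrMr// ler_pdivlMr// ![(u * _)%R]mulrC; apply/andP; split.
    by apply: le_trans t0; rewrite ler_nat; move: bu; rewrite /b -/t; lia.
  have uN : (N%:R * u <= N%:R)%R by rewrite ler_piMr// ltW.
  have [tN|tN] := leqP t N.-1.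
    by apply/ltW; apply: lt_le_trans t1 _; rewrite ler_nat; move: bu; rewrite /b -/t; lia.
  by apply: le_trans uN _; rewrite ler_nat; move: bu; rewrite /b -/t; lia.
rewrite integral_cst//= mul1e lebesgue_measure_itv /= lte_fin.
case: ifP => _; last by rewrite lee_fin invr_ge0 ltW.
by rewrite -EFinD lee_fin -mulrBl -natrB ?leqnSn// subSnn mul1r.
Qed.

Lemma integral_with_uniform (g : T -> \bar R) : measurable_fun setT g ->
  (forall w, 0 <= g w) -> \int[with_uniform]_p g p.1 = \int[mu]_w g w.
Proof.
move=> mg g0; rewrite /with_uniform (fubini_tonelli1 (g \o fst)) /=; last 2 first.
- by apply: measurableT_comp => //; exact: measurable_fst.
- by move=> p; exact: g0.
apply: eq_integral => w _; rewrite /fubini_F /= integral_cst//.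
by rewrite -[RHS]mule1; congr (_ * _); exact: probability_setT.
Qed.

Lemma lenergyE (X : T -> R) : measurable_fun setT X -> (forall w, 0 <= X w <= 1)%R ->
  lenergy mu X = \int[mu]_w \int[mu]_w' logk (X w - X w').
Proof.
move=> mX X01; rewrite /lenergy (fubini_tonelli1 (logk \o pdist X))//.
- exact: measurable_logk_pdist.
- by move=> p; apply/logk_ge0/pdist_le1.
Qed.

End uniform_randomization.

Lemma lenergy_with_uniform {R : realType} {d} {T : measurableType d}
    (mu : probability T R) (X : T -> R) :
  measurable_fun setT X -> (forall w, 0 <= X w <= 1) ->
  lenergy (with_uniform mu) (X \o fst) = lenergy mu X.
Proof.
move=> mX X01.
have mXf : measurable_fun setT (X \o (@fst T R)).
  by apply: measurableT_comp => //; exact: measurable_fst.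
rewrite !lenergyE//; last by move=> w; exact: X01.
pose f (p : T * T) := logk (pdist X p).
have f0 p : (0 <= f p)%E by apply/logk_ge0/pdist_le1.
have mf : measurable_fun setT f by exact: measurable_logk_pdist.
transitivity (\int[with_uniform mu]_p (fubini_F mu f) p.1)%E.
  apply: eq_integral => p _.
  rewrite (integral_with_uniform mu (g := fun w' => f (p.1, w')))//.
  exact: measurableT_comp.
rewrite integral_with_uniform//; last by move=> w; apply: integral_ge0.
exact: measurable_fun_fubini_tonelli_F.
Qed.

(** * Energy of measures carried by the real line *)

Lemma measurable_section {R : realType} {d d'} {T : measurableType d} {T' : measurableType d'}
    (k : T * T' -> \bar R) (z : T) :
  measurable_fun setT k -> measurable_fun setT (fun w => k (z, w)).
Proof.
by move=> mk; apply: (@measurableT_comp _ _ _ _ _ _ k _ (pair z)) => //; exact: pair1_measurable.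
Qed.

Section energy_on_line.
Context {R : realType}.

Lemma log_kernel_real (x y : R) : log_kernel (real_complex R x) (real_complex R y) = logk (x - y).
Proof. by rewrite /log_kernel -rmorphB normc_def /= expr0n addr0 sqrtr_sqr. Qed.

(** A real-valued version of the identity of a measure carried by the segment from
    [a] to [b], with values in that segment everywhere and not only almost
    everywhere. *)
Definition clip (a b : R) (z : borelC R) : R := Num.max a (Num.min b (complex.Re z)).

Lemma measurable_clip a b : measurable_fun setT (clip a b).
Proof.
apply: measurable_maxr => //; apply: measurable_minr => //; exact: measurable_Re.
Qed.

Lemma clip_itv a b z : a <= b -> a <= clip a b z <= b.
Proof. by move=> ab; rewrite /clip le_max lexx /= ge_max ab ge_min lexx. Qed.

Lemma clip_id a b x : a <= x <= b -> clip a b (real_complex R x) = x.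
Proof. by move=> /andP[ax xb]; rewrite /clip /= min_r// max_r. Qed.

(** Almost every point is real and lies between [a] and [b], so [clip a b] computes
    the same kernel, in both variables. *)
Lemma energy_clip (mu : probability (borelC R) R) a b : 0 <= a -> a <= b -> b <= 1 ->
  mu (~` (real_complex R @` `[a, b]%classic) : set (borelC R)) = 0%E ->
  energy mu = lenergy mu (clip a b).
Proof.
move=> a0 ab b1 mu0.
have c01 z : 0 <= clip a b z <= 1.
  by have /andP[? ?] := clip_itv z ab; apply/andP; split; lra.
rewrite (lenergyE mu (measurable_clip a b) c01).
have aeE (Q : borelC R -> Prop) :
    (forall z, (real_complex R @` `[a, b]%classic) z -> Q z) -> {ae mu, forall z, Q z}.
  move=> EQ; exists (~` (real_complex R @` `[a, b]%classic)); split => //.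
    by apply: measurableC; exact: measurable_image_real.
  by move=> z nQ /EQ.
have cE z w : (real_complex R @` `[a, b]%classic) z -> (real_complex R @` `[a, b]%classic) w ->
    log_kernel z w = logk (clip a b z - clip a b w).
  by move=> [x /=] + <- [y /=] + <-; rewrite !in_itv /= => xab yab; rewrite log_kernel_real !clip_id.
pose f (p : borelC R * borelC R) := log_kernel p.1 p.2.
pose g (p : borelC R * borelC R) := logk (pdist (clip a b) p).
have mf : measurable_fun setT f by exact: measurable_log_kernel.
have mg : measurable_fun setT g by apply: measurable_logk_pdist; exact: measurable_clip.
have g0 p : (0 <= g p)%E by apply/logk_ge0/pdist_le1.
rewrite /energy; apply: ae_eq_integral => //.
- rewrite (_ : (fun z => _) = (fun z => fubini_F mu f^\+ z - fubini_F mu f^\- z)%E); last first.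
    by apply/funext => z; rewrite integralE; congr (_ - _)%E; apply: eq_integral => w _;
      rewrite ?funeposE ?funenegE.
  apply: emeasurable_funB; apply: measurable_fun_fubini_tonelli_F => //.
  + exact: measurable_funepos.
  + exact: measurable_funeneg.
- exact: (measurable_fun_fubini_tonelli_F g).
apply: (aeE _) => z zE _; apply: ae_eq_integral => //.
- exact: (measurable_section (z : borelC R) mf).
- exact: (measurable_section (z : borelC R) mg).
by apply: (aeE _) => w wE _; exact: cE.
Qed.

End energy_on_line.

Section transfer.
Context {R : realType}.

Lemma measurable_uniform_Gdelta (r : nat -> R) : measurable (uniform_Gdelta r).
Proof.
apply: bigcap_measurable => [|m _]; first by exists 1%N.
apply: bigcup_measurable => n _; apply: bigcup_measurable => j _.
exact: measurable_itv.
Qed.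

Lemma energy_pushforward_real {d} {T : measurableType d} (P : probability T R) (G : T -> R)
    (phi : {mfun T >-> borelC R}) :
  measurable_fun setT G -> (forall w, 0 <= G w <= 1) ->
  (forall w, phi w = real_complex R (G w)) ->
  energy (distribution P phi) = lenergy P G.
Proof.
move=> mG G01 phiE.
have c01 (z : borelC R) : 0 <= clip 0 1 z <= 1 by exact: clip_itv.
have cG w : clip 0 1 (phi w) = G w by rewrite phiE clip_id.
have off : phi @^-1` (~` (real_complex R @` `[0, 1]%classic)) = set0.
  apply/seteqP; split => // w /=; apply; exists (G w) => //=.
  by rewrite in_itv /= G01.
have off0 : distribution P phi (~` (real_complex R @` `[0, 1]%classic) : set (borelC R)) = 0%E.
  by rewrite -(measure0 P) -off.
rewrite (energy_clip (lexx 0) ler01 (lexx 1) off0).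
have mc : measurable_fun setT (clip 0 1 : borelC R -> R) by exact: measurable_clip.
rewrite !lenergyE//.
pose g (p : borelC R * borelC R) := logk (pdist (clip 0 1) p).
have g0 p : (0 <= g p)%E by apply/logk_ge0/pdist_le1.
have mg : measurable_fun setT g by exact: measurable_logk_pdist.
have mphi : measurable_fun setT phi by [].
rewrite ge0_integral_pushforward//; last 2 first.
- exact: (measurable_fun_fubini_tonelli_F g).
- by move=> z _; apply: integral_ge0 => w _; exact: g0 (z, w).
rewrite preimage_setT; apply: eq_integral => w _ /=.
rewrite ge0_integral_pushforward//; last 2 first.
- exact: (measurable_section (phi w) mg).
- by move=> z _; exact: g0 (phi w, z).
by rewrite preimage_setT; apply: eq_integral => w' _ /=; rewrite !cG.
Qed.

Lemma lenergy_scale {d} {T : measurableType d} (P : probability T R) (X : T -> R) (m t : R) :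
  measurable_fun setT X -> (forall w, 0 <= X w <= 1) -> 0 < t <= 1 ->
  (lenergy P (fun w => m + t * X w)%R <= lenergy P X + (- ln t)%:E)%E.
Proof.
move=> mX X01 /andP[t0 t1].
have E p : pdist (fun w => m + t * X w)%R p = t * pdist X p by rewrite /pdist; ring.
have lt0 : 0 <= - ln t by rewrite oppr_ge0 ln_le0.
have mL := measurable_logk_pdist mX.
have nL p : (0 <= logk (pdist X p))%E by apply/logk_ge0/pdist_le1.
apply: (@le_trans _ _ (\int[P \x P]_p (logk (pdist X p) + cst (- ln t)%:E p))%E).
  apply: ge0_le_integral => //=.
  - move=> p _; rewrite E; apply: logk_ge0; rewrite normrM (gtr0_norm t0).
    by rewrite mulr_ile1 ?(ltW t0)//; exact: pdist_le1.
  - apply: measurable_logk_pdist; apply: measurable_funD => //; exact: measurable_funM.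
  - exact: emeasurable_funD.
  - move=> p _; rewrite E; have [->|D0] := eqVneq (pdist X p) 0; first by rewrite mulr0 logk0 addye.
    have tn0 : t != 0 by rewrite gt_eqF.
    rewrite !logkE ?mulf_neq0//= -EFinD lee_fin normrM (gtr0_norm t0).
    by rewrite lnM ?posrE ?normr_gt0//; lra.
rewrite (ge0_integralD (P \x P)%E measurableT)//=.
rewrite leeD2l// integral_cst// -[leRHS]mule1 lee_wpmul2l//.
have h : ((P \x P) setT <= 1)%E by rewrite prod_probability_setT.
exact: h.
Qed.
End transfer.

(** * Equality of the capacities *)

Section capacity_transfer.
Context {R : realType}.
Local Notation C := (real_complex R).

Lemma borel_probabilities_on_subset (A B : set R) (mu : probability (borelC R) R) :
  measurable A -> measurable B -> A `<=` B ->
  borel_probabilities_on (C @` A) mu -> borel_probabilities_on (C @` B) mu.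
Proof.
move=> mA mB AB muA.
have mCA := measurableC (measurable_image_real mA).
have mCB := measurableC (measurable_image_real mB).
apply: (subset_measure0 mCB mCA) => // z nB [x Ax xz]; apply: nB.
by exists x => //; exact: AB.
Qed.

(** On a single point the kernel is identically [+oo]. *)
Lemma finite_energy_two_points (J : set R) (mu : probability (borelC R) R) :
  is_interval J -> J `<=` `[0, 1]%classic ->
  borel_probabilities_on (C @` J) mu -> (energy mu < +oo)%E ->
  exists x y, [/\ J x, J y & x < y].
Proof.
move=> iJ J01 muJ fin; apply: contrapT => no.
have [x0 [x00 x01 Jx0]] : exists x0, [/\ 0 <= x0, x0 <= 1 & J `<=` `[x0, x0]%classic].
  have [[x Jx]|/nonemptyPn J0] := pselect (J !=set0); last first.
    by exists 0; rewrite J0; split => //; exact: sub0set.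
  have := J01 _ Jx; rewrite /= in_itv /= => /andP[x0 x1].
  exists x; split => // y Jy; rewrite /= in_itv /= -eq_le.
  apply: contrapT => /negP xy; apply: no.
  by case: (ltgtP x y) xy => // h _; [exists x, y|exists y, x].
have mu0 : borel_probabilities_on (C @` `[x0, x0]%classic) mu.
  by apply: borel_probabilities_on_subset muJ => //; exact: is_interval_measurable.
move: fin; rewrite (energy_clip x00 (lexx x0) x01 mu0) /lenergy.
have -> : (fun p => logk (pdist (clip x0 x0) p)) = cst +oo%E :> (borelC R * borelC R -> \bar R).
  apply/funext => p; rewrite /pdist.
  have cE z : clip x0 x0 z = x0.
    by apply/eqP; rewrite eq_le andbC; exact: clip_itv.
  by rewrite !cE subrr logk0.
rewrite integral_cst//.
have -> : (+oo * (mu \x mu) setT = +oo :> \bar R)%E.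
  by rewrite prod_probability_setT mule1.
by rewrite ltxx.
Qed.

(** The contraction by [1 - t] towards the middle of [J] costs [- ln (1 - t)] and
    brings [X] at distance at least [2 s] from the ends of [J], which accommodates
    the total move [s] of [redistribution_limit]. *)
Lemma redistribute_measure (r : nat -> R) (K : nat) (J : set R)
    (mu : probability (borelC R) R) (e : R) :
  thick_radii r K -> is_interval J -> J `<=` `[0, 1]%classic ->
  borel_probabilities_on (C @` J) mu -> (energy mu < +oo)%E -> 0 < e ->
  exists2 nu : probability (borelC R) R,
    borel_probabilities_on (C @` (J `&` uniform_Gdelta r)) nu &
    (energy nu <= energy mu + e%:E)%E.
Proof.
move=> hr iJ J01 muJ fin e0.
have [x [y [Jx Jy xy]]] := finite_energy_two_points iJ J01 muJ fin.
have J01' t : J t -> 0 <= t <= 1 by move=> /J01; rewrite /= in_itv.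
have infJ : has_inf J.
  by split; [exists x|exists 0 => t /J01' /andP[]].
have supJ : has_sup J.
  by split; [exists x|exists 1 => t /J01' /andP[]].
pose a := inf J; pose b := sup J.
have Jab : J `<=` `[a, b]%classic.
  move=> t Jt; rewrite /= in_itv /=; apply/andP; split.
    by apply: ge_inf => //; case: infJ.
  by apply: ub_le_sup => //; case: supJ.
have abJ t : a < t -> t < b -> J t.
  move=> /(inf_lt (proj1 infJ)) [u Ju ut] /(sup_gt (proj1 supJ)) [v Jv tv].
  by apply: (iJ u v) => //; rewrite !ltW.
have a0 : 0 <= a by apply: lb_le_inf; [exists x|move=> t /J01' /andP[]].
have b1 : b <= 1 by apply: ge_sup; [exists x|move=> t /J01' /andP[]].
have ab : a < b.
  have := Jab _ Jx; have := Jab _ Jy; rewrite /= !in_itv /= => /andP[_ yb] /andP[ax _].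
  by apply: le_lt_trans ax _; exact: lt_le_trans yb.
have mJ : measurable J by exact: is_interval_measurable.
have muab : borel_probabilities_on (C @` `[a, b]%classic) mu.
  exact: borel_probabilities_on_subset muJ.
have E0 := energy_clip a0 (ltW ab) b1 muab.
pose t : R := Num.min 2^-1 (e / 8).
have t0 : 0 < t by rewrite lt_min invr_gt0 ltr0n divr_gt0.
have t2 : t <= 2^-1 by rewrite ge_min lexx.
have te : t <= e / 8 by rewrite ge_min lexx orbT.
have lnt : - ln (1 - t) <= e / 2.
  apply: le_trans (oppr_ln1B _) _; first by rewrite (ltW t0).
  by lra.
pose X z := t * (a + b) / 2 + (1 - t) * clip a b z.
pose s := t * (b - a) / 4.
have s0 : 0 < s by rewrite divr_gt0// mulr_gt0// subr_gt0.
have mcl : measurable_fun setT (clip a b) by exact: measurable_clip.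
have cl01 z : 0 <= clip a b z <= 1.
  by have /andP[? ?] := clip_itv z (ltW ab); apply/andP; split; lra.
have mX : measurable_fun setT X.
  by apply: measurable_funD => //; exact: measurable_funM.
have XI z : a + s *+ 2 <= X z <= b - s *+ 2.
  have /andP[c1 c2] := clip_itv z (ltW ab); rewrite /X /s.
  have c1' : 0 <= (1 - t) * (clip a b z - a) by rewrite mulr_ge0// subr_ge0//; lra.
  have c2' : 0 <= (1 - t) * (b - clip a b z) by rewrite mulr_ge0// subr_ge0//; lra.
  by apply/andP; split; lra.
have Xs z : s <= X z <= 1 - s.
  by have /andP[? ?] := XI z; apply/andP; split; lra.
have X01 z : 0 <= X z <= 1.
  by have /andP[? ?] := Xs z; apply/andP; split; lra.
have XE : (lenergy mu X <= energy mu + (e / 2)%:E)%E.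
  apply: (@le_trans _ _ (lenergy mu (clip a b) + (- ln (1 - t))%:E)%E).
    by apply: lenergy_scale => //; apply/andP; split; lra.
  by rewrite E0 leeD2l// lee_fin.
pose P := with_uniform mu.
pose X' := X \o (@fst (borelC R) R).
have mX' : measurable_fun setT X'.
  by apply: measurableT_comp => //; exact: measurable_fst.
have X'E : lenergy P X' = lenergy mu X by exact: lenergy_with_uniform.
have fin' : (lenergy P X' < +oo)%E.
  by rewrite X'E (le_lt_trans XE)// lte_add_pinfty// ltry.
have e20 : 0 < e / 2 by rewrite divr_gt0.
have [G [mG GX GS GE]] := redistribution_limit hr (splittable_with_uniform mu) mX' s0
  (fun w => Xs w.1) fin' e20.
have GJ w : J (G w).
  have /andP[? ?] := XI w.1; have := GX w; rewrite /X' /= ler_norml => /andP[? ?].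
  by apply: abJ; lra.
have mphi : measurable_fun setT (C \o G : _ -> borelC R).
  by apply: measurableT_comp => //; exact: measurable_real_complex.
pose mphi_mixin := isMeasurableFun.Build _ _ _ _ _ mphi.
pose phi : {mfun _ >-> _} := HB.pack (C \o G : _ -> borelC R) mphi_mixin.
exists (distribution P phi).
  have off : phi @^-1` (~` (C @` (J `&` uniform_Gdelta r))) = set0.
    by apply/seteqP; split => // w /=; apply; exists (G w).
  by rewrite /borel_probabilities_on /= -(measure0 P) -off.
rewrite (@energy_pushforward_real _ _ _ _ G)//; last by move=> w; exact: J01'.
apply: le_trans GE _; rewrite X'E; apply: le_trans (leeD2r _ XE) _.
by rewrite -addeA -EFinD -splitr.
Qed.

End capacity_transfer.


Theorem corollary1p7 (R : realType) (r : nat -> R)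
    (hr : subexponential_radii r \/ stretched_exponential_radii r)
    (J : set R) (hJ : is_interval J) (hJ01 : J `<=` `[0, 1]%classic) :
  Cap (real_complex R @` (J `&` uniform_Gdelta r)) = Cap (real_complex R @` J).
Proof.
have [K hK] := exists_thick_radii hr.
have mJ : measurable J by exact: is_interval_measurable.
have mJS : measurable (J `&` uniform_Gdelta r).
  by apply: measurableI => //; exact: measurable_uniform_Gdelta.
rewrite /Cap; congr (expeR (- _))%E; apply/eqP; rewrite eq_le; apply/andP; split.
  apply/ereal_infP => _ [mu muJ <-].
  have [fin|] := ltP (energy mu) +oo%E; last by rewrite leye_eq => /eqP ->; rewrite leey.
  apply/lee_addgt0Pr => e e0.
  have [nu nuS nuE] := redistribute_measure hK hJ hJ01 muJ fin e0.
  by apply: le_trans nuE; apply: ereal_inf_lbound; exists nu.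
apply/ereal_infP => _ [mu muJ <-]; apply: ereal_inf_lbound; exists mu => //.
exact: (borel_probabilities_on_subset mJS mJ (@subIsetl _ _ _)).
Qed.
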